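(* Let $n$ be a positive integer. The CW topology on $\mathcal{P}(n)$ (or on $\mathcal{P}_{\mathbb{Q}}(n)$, or on $\mathcal{D}(n)$) is strictly finer than the metric topology coming from $\delta^V$ or $\delta^H$.
   Context: $\mathcal{P}(n)$ is the set of polytopes in $\mathbb{R}^n$ (not necessarily full-dimensional; single points are excluded when considering the CW topology), $\mathcal{P}_{\mathbb{Q}}(n)$ the subset of polytopes with rational edge directions, and $\mathcal{D}(n)$ the subset of Delzant polytopes (full-dimensional polytopes such that every vertex lies in exactly $n$ edges, all edge directions are rational, and at each vertex the primitive integer edge vectors form a basis of $\mathbb{Z}^n$). The metric topology is that of the Hausdorff distance $\delta^H(P,Q)=\max\{\max_{x\in P}\mathrm{dist}(x,Q),\max_{y\in Q}\mathrm{dist}(y,P)\}$, where $\mathrm{dist}(x,Q)=\min_{y\in Q}\|x-y\|$; on full-dimensional polytopes (in particular on $\mathcal{D}(n)$) it agrees with the topology of the symmetric difference distance $\delta^V(P,Q)=\mathrm{Vol}(P\setminus Q)+\mathrm{Vol}(Q\setminus P)$. CW topology. The normal fan $\mathcal{N}(P)$ of a polytope consists of the cones $\{\alpha\in(\mathbb{R}^n)^*:\langle\alpha,p-q\rangle\ge0\ \forall p\in F,q\in P\}$ for the nonempty faces $F$ of $P$; a complete fan $\Sigma'$ refines $\Sigma$ if every cone of $\Sigma'$ is contained in a cone of $\Sigma$. For a polytopal fan $\mathcal{N}$ (the normal fan of some polytope), the set $\mathcal{P}(\mathcal{N})$ of polytopes $P$ such that $\mathcal{N}$ refines $\mathcal{N}(P)$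 is identified, via the support function $h_P(\alpha)=\max_{x\in P}\langle\alpha,x\rangle$, with a closed polyhedral cone in the finite-dimensional space of functions that are linear on each cone of $\mathcal{N}$. Let $\widetilde{\mathcal{P}(n)}$ be the quotient of $\mathcal{P}(n)\setminus\{\text{points}\}$ by translations and positive scalings, and let $\bar e_{\mathcal{N}}$ (for $\mathcal{N}\ne\{(\mathbb{R}^n)^*\}$) be the image of $\mathcal{P}(\mathcal{N})\setminus\{\text{points}\}$, with the quotient topology. These are the closed cells of a regular CW complex structure on $\widetilde{\mathcal{P}(n)}$, in whose topology a set is closed iff its intersection with each $\bar e_{\mathcal{N}}$ is closed. The map $P\mapsto(\widetilde P,\mathrm{c}(P),\mathrm{r}(P))$, where $\widetilde P$ is the class of $P$ and $\mathrm{c}(P),\mathrm{r}(P)$ are the center and radius of the smallest ball enclosing $P$, is a bijection $\mathcal{P}(n)\setminus\{\text{points}\}\to\widetilde{\mathcal{P}(n)}\times\mathbb{R}^n\times(0,\infty)$; the CW topology on $\mathcal{P}(n)\setminus\{\text{points}\}$ is the product topology transported through this bijection, and its subsets $\mathcal{P}_{\mathbb{Q}}(n)$, $\mathcal{D}(n)$ carry the subspace topology.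
   Formalization: For n = 1 the CW and metric topologies coincide (all segments have one shape, so both are the topology of center and radius); the claim is therefore proved as ''finer'' for all n ≥ 1 and ''strictly finer'' only for n ≥ 2. *)

(* Defs.v *)
From HB Require Import structures.
From mathcomp Require Import all_boot all_order all_algebra generic_quotient.
From mathcomp Require Import all_classical all_reals all_analysis.

Set Implicit Arguments.
Unset Strict Implicit.
Unset Printing Implicit Defensive.

Import Order.TTheory GRing.Theory Num.Theory numFieldNormedType.Exports.
Local Open Scope classical_set_scope.
Local Open Scope ring_scope.

(* R^n is ['rV[R]_n].  Its dual is identified with ['rV[R]_n] through [dotp]. *)
Section euclidean.
Context {R : realType} {n : nat}.
Implicit Types (x y a b : 'rV[R]_n) (P Q A : set 'rV[R]_n).

Definition dotp a x : R := \sum_(i < n) a 0 i * x 0 i.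

(* The library's norm on matrices is the maximum norm. *)
Definition l2norm x : R := Num.sqrt (dotp x x).

Definition conv (s : seq 'rV[R]_n) : set 'rV[R]_n :=
  [set x | exists c : 'I_(size s) -> R,
     [/\ forall i, 0 <= c i, \sum_i c i = 1 & x = \sum_i c i *: s`_i]].

Definition is_polytope P := exists s : seq 'rV[R]_n, s != [::] /\ P = conv s.

Definition is_point P := exists x, P = [set x].

Definition support_function P a : R := sup [set dotp a x | x in P].

Definition face P a : set 'rV[R]_n :=
  [set x | P x /\ forall y, P y -> dotp a y <= dotp a x].

Definition is_face P F := F !=set0 /\ exists a, F = face P a.

Definition normal_cone P F : set 'rV[R]_n :=
  [set a | forall p q, F p -> P q -> 0 <= dotp a (p - q)].

Definition normal_fan P : set (set 'rV[R]_n) :=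
  [set C | exists2 F, is_face P F & C = normal_cone P F].

Definition refines (N' N : set (set 'rV[R]_n)) :=
  forall C', N' C' -> exists2 C, N C & C' `<=` C.

Definition polytopal_fan (N : set (set 'rV[R]_n)) :=
  exists2 P, is_polytope P & N = normal_fan P.

Definition is_edge P F x y := [/\ is_face P F, x != y & F = conv [:: x; y]].

Definition is_vertex P x := is_face P [set x].

Definition rational_direction (d : 'rV[R]_n) :=
  exists (c : R) (v : 'rV[rat]_n), d = c *: map_mx ratr v.

Definition rational_edges P :=
  forall F x y, is_edge P F x y -> rational_direction (y - x).

(* P contains n + 1 affinely independent points x, x + M_1, ..., x + M_n. *)
Definition full_dimensional P :=
  exists x (M : 'M[R]_n),
    [/\ P x, forall i, P (x + row i M) & M \in unitmx].

Definition primitive (u : 'rV[int]_n) :=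
  (\big[gcdn/0]_(i < n) `|u 0%R i|)%N = 1%N.

Definition primitive_edge_vector P x (u : 'rV[int]_n) :=
  primitive u /\ exists F y (t : R),
    [/\ is_edge P F x y, 0 < t & y - x = t *: map_mx intr u].

(* The rows of B form a basis of Z^n. *)
Definition lattice_basis (B : 'M[int]_n) :=
  forall z : 'rV[int]_n, exists! c : 'rV[int]_n, z = c *m B.

Definition is_delzant P :=
  [/\ full_dimensional P,
      forall x, is_vertex P x -> ([set F | (exists y z, is_edge P F y z) /\ F x] #= `I_n)%card,
      rational_edges P
    & forall x, is_vertex P x -> exists2 B : 'M[int]_n, lattice_basis B &
        [set u | primitive_edge_vector P x u] = [set row i B | i in setT]].

(* On polytopes, which are compact, these infima and suprema are attained. *)
Definition dist x Q : R := inf [set l2norm (x - y) | y in Q].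

Definition hausdorff_dist P Q : R :=
  Num.max (sup [set dist x Q | x in P]) (sup [set dist y P | y in Q]).

(* n-dimensional Lebesgue outer measure, which coincides with Lebesgue measure
   on measurable sets. *)
Definition box a b : set 'rV[R]_n := [set x | forall i, a 0 i <= x 0 i <= b 0 i].

Definition vol A : \bar R :=
  ereal_inf [set v | exists a b : nat -> 'rV[R]_n,
    [/\ forall k i, a k 0 i <= b k 0 i,
        A `<=` \bigcup_k box (a k) (b k)
      & v = (\sum_(0 <= k <oo) (\prod_(i < n) (b k 0 i - a k 0 i))%:E)%E]].

Definition volume_dist P Q : \bar R := (vol (P `\` Q) + vol (Q `\` P))%E.

Definition closed_ball2 c (r : R) : set 'rV[R]_n := [set x | l2norm (x - c) <= r].

Definition smallest_ball P (cr : 'rV[R]_n * R) :=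
  [/\ 0 <= cr.2, P `<=` closed_ball2 cr.1 cr.2 &
      forall c r, 0 <= r -> P `<=` closed_ball2 c r -> cr.2 <= r].

Definition center P : 'rV[R]_n := (get (smallest_ball P)).1.
Definition radius P : R := (get (smallest_ball P)).2.

End euclidean.

(* P(n) minus the points *)
Record polytope (R : realType) (n : nat) := Polytope {
  pset :> set 'rV[R]_n;
  psetP : is_polytope pset;
  pset_not_point : ~ is_point pset }.

HB.instance Definition _ R n := gen_eqMixin (polytope R n).
HB.instance Definition _ R n := gen_choiceMixin (polytope R n).

Section shapes.
Context {R : realType} {n : nat}.

Definition same_shape (P Q : polytope R n) : bool :=
  `[< exists (l : R) (t : 'rV[R]_n),
        0 < l /\ (Q : set _) = [set l *: x + t | x in P] >].

Lemma same_shape_refl : reflexive same_shape.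
Proof.
move=> P; apply/asboolP; exists 1, 0; split => //.
under eq_imagel do rewrite scale1r addr0.
by rewrite image_id.
Qed.

Lemma same_shape_sym_imp P Q : same_shape P Q -> same_shape Q P.
Proof.
move=> /asboolP[l [t [l0 QE]]]; apply/asboolP.
exists l^-1, (- (l^-1 *: t)); split; first by rewrite invr_gt0.
rewrite QE image_comp.
under eq_imagel do
  rewrite /= scalerDr scalerA mulVf ?gt_eqF// scale1r addrK.
by rewrite image_id.
Qed.

Lemma same_shape_sym : symmetric same_shape.
Proof. by move=> P Q; apply/idP/idP; exact: same_shape_sym_imp. Qed.

Lemma same_shape_trans : transitive same_shape.
Proof.
move=> Q P S /asboolP[l [t [l0 QE]]] /asboolP[m [u [m0 SE]]].
apply/asboolP; exists (m * l), (m *: t + u); split; first exact: mulr_gt0.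
rewrite SE QE image_comp.
by apply: eq_imagel => x _ /=; rewrite scalerDr scalerA addrA.
Qed.

Canonical same_shape_equiv :=
  EquivRel same_shape same_shape_refl same_shape_sym same_shape_trans.

End shapes.

Definition polytope_shape (R : realType) (n : nat) : Type :=
  {eq_quot @same_shape_equiv R n}%qT.
HB.instance Definition _ R n := Choice.on (polytope_shape R n).
HB.instance Definition _ R n := EqQuotient.on (polytope_shape R n).

Definition shape_class {R : realType} {n : nat} (P : polytope R n) : polytope_shape R n :=
  (\pi_(polytope_shape R n) P)%qT.

Section CW.
Context {R : realType} {n : nat}.
Implicit Type N : set (set 'rV[R]_n).

(* P(N) minus the points.  All vector space topologies on a finite-dimensional
   space that are Hausdorff coincide, so the topology induced through support
   functions by the space of functions linear on each cone of N is the one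
   induced by pointwise convergence. *)
Definition fan_polytopes N : set (polytope R n) :=
  [set P | refines N (normal_fan P)].

Definition fan_support N (P : fan_polytopes N) :
  {ptws 'rV[R]_n -> R} := support_function (val P : polytope R n).

Definition fan_cone N := initial_topology (@fan_support N).

Definition cell_map N (P : fan_cone N) : polytope_shape R n :=
  shape_class (val (P : fan_polytopes N)).

Definition cell N : set (polytope_shape R n) := range (@cell_map N).

(* closed in the quotient topology of [cell N] *)
Definition cell_closed N (C : set (polytope_shape R n)) :=
  C `<=` cell N /\ closed (@cell_map N @^-1` C).

Definition CW_closed (C : set (polytope_shape R n)) :=
  forall N, polytopal_fan N -> N <> [set setT] -> cell_closed N (C `&` cell N).

Definition CW_open (U : set (polytope_shape R n)) := CW_closed (~` U).

Lemma CW_openE U : CW_open U = forall N, polytopal_fan N -> N <> [set setT] ->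
  open (@cell_map N @^-1` U).
Proof.
apply/propext; split=> h N pN N1.
- have [_] := h N pN N1.
  rewrite preimage_setI preimage_range setIT preimage_setC => /closed_openC.
  by rewrite setCK.
- split; first by move=> ? [].
  rewrite preimage_setI preimage_range setIT preimage_setC.
  exact/open_closedC/h.
Qed.

Lemma CW_openT : CW_open setT.
Proof. by rewrite CW_openE => N _ _; rewrite preimage_setT; exact: openT. Qed.

Lemma CW_openI : setI_closed CW_open.
Proof.
move=> A B; rewrite !CW_openE => oA oB N pN N1.
by rewrite preimage_setI; apply: openI; [exact: oA|exact: oB].
Qed.

Lemma CW_open_bigU (I : Type) (f : I -> set (polytope_shape R n)) :
  (forall i, CW_open (f i)) -> CW_open (\bigcup_i f i).
Proof.
move=> of_; rewrite CW_openE => N pN N1; rewrite preimage_bigcup.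
by apply: bigcup_open => i _; move: (of_ i); rewrite CW_openE; exact.
Qed.

HB.instance Definition _ := isOpenTopological.Build (polytope_shape R n)
  CW_openT CW_openI CW_open_bigU.

(* The radius is positive on [polytope R n], and (0, +oo) has the topology
   induced from R. *)
Definition CW_coordinates (P : polytope R n) : polytope_shape R n * 'rV[R]_n * R :=
  (shape_class P, center P, radius P).

Definition CW_polytope := initial_topology CW_coordinates.

(* Topologies on a subset S of [polytope R n] are given by their families of
   open sets; each open set is a subset of S. *)
Definition CW_topology (S : set (polytope R n)) : set_system (polytope R n) :=
  [set A | exists2 U : set CW_polytope, open U & A = U `&` S].

Definition metric_topology (d : polytope R n -> polytope R n -> \bar R)
    (S : set (polytope R n)) : set_system (polytope R n) :=
  [set A | A `<=` S /\ forall P, A P -> exists2 e : R, 0 < e &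
     forall Q, S Q -> (d P Q < e%:E)%E -> A Q].

Definition hausdorff_topology :=
  metric_topology (fun P Q => (hausdorff_dist P Q)%:E).

(* On polytopes that are not full-dimensional [volume_dist] is only a
   pseudometric. *)
Definition volume_topology := metric_topology (fun P Q => volume_dist P Q).

Definition all_polytopes : set (polytope R n) := setT.
Definition rational_polytopes : set (polytope R n) := [set P | rational_edges P].
Definition delzant_polytopes : set (polytope R n) := [set P | is_delzant P].

End CW.

(* Main.v *)
Require Import Defs.
From mathcomp Require Import all_boot all_order all_algebra generic_quotient.
From mathcomp Require Import all_classical all_reals all_analysis.
From mathcomp Require Import ring lra.

(** The topologies are compared through support functions.

    The CW topology is finer.  If the support functions of two polytopes are close
    uniformly on the unit sphere, then a separating hyperplane at a nearest point shows
    that the Hausdorff distance is small ([hausdorff_dist_le]).  Each polytope minus the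
    other is then a thin shell around a convex set, which is covered by boxes of small
    total volume ([vol_shell]), so the volume distance is small as well
    ([volume_dist_small]).  It remains to see that the support function depends
    continuously on the CW coordinates ([CW_nbhs_support_close]).  On a cell the topology
    is that of pointwise convergence of support functions, which is locally uniform
    because support functions are Lipschitz ([support_close_net]).  The parallelogram law
    makes the smallest enclosing ball unique and continuous for uniform convergence
    ([radius_close], [center_close]).  Hence the support function of the polytope
    normalized by its ball is continuous on each cell, that is, on the space of shapes,
    and the radius and the centre give back the support function of the polytope itself.

    It is strictly finer when n > 1.  For fixed [v] and [u], the directions [k v + u]
    with [k] large all lie in one cone of a given fan ([fan_eventual_cone]), so on a
    given cell the second differences of the support function along this progression,
    called kinks here, vanish for large [k].  Therefore the inequalities
    [kink v u k P < c k], for all [k], define a CW open set, however fast the positive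
    numbers [c k] decrease ([small_kinks_open]).  Now insert a
    tiny chain of edges of slopes 1, ..., k + 1 between the bottom side and the right
    side of a square.  This polygon has a positive k-th kink, while the square has none; as k grows and the chain shrinks, the polygons converge to
    the square.  With [c k] the k-th kink of the k-th polygon, the square has a CW
    neighbourhood that contains none of the polygons.  The directions of
    consecutive edges form a basis of the lattice, so the products of these polygons with a cube are
    Delzant ([smooth_conv_delzant]).  One sequence thus serves for the three sets of
    polytopes and for both distances. *)

Set Implicit Arguments.
Unset Strict Implicit.
Unset Printing Implicit Defensive.

Import Order.TTheory GRing.Theory Num.Theory numFieldNormedType.Exports.
Import Defs.
Local Open Scope classical_set_scope.
Local Open Scope ring_scope.

(** * The Euclidean structure of R^n *)

Section euclidean_space.
Context {R : realType} {n : nat}.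
Implicit Types a b x y : 'rV[R]_n.

Lemma dotpE a x : dotp a x = (a *m x^T) 0 0.
Proof. by rewrite mxE; apply: eq_bigr => i _; rewrite mxE. Qed.

Lemma dotpC a x : dotp a x = dotp x a.
Proof. by apply: eq_bigr => i _; rewrite mulrC. Qed.

Lemma dotpDl a b x : dotp (a + b) x = dotp a x + dotp b x.
Proof. by rewrite !dotpE mulmxDl mxE. Qed.

Lemma dotpNl a x : dotp (- a) x = - dotp a x.
Proof. by rewrite !dotpE mulNmx mxE. Qed.

Lemma dotpZl (k : R) a x : dotp (k *: a) x = k * dotp a x.
Proof. by rewrite !dotpE -scalemxAl mxE. Qed.

Lemma dotpDr a x y : dotp a (x + y) = dotp a x + dotp a y.
Proof. by rewrite dotpC dotpDl !(dotpC a). Qed.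

Lemma dotpNr a x : dotp a (- x) = - dotp a x.
Proof. by rewrite dotpC dotpNl (dotpC a). Qed.

Lemma dotpZr (k : R) a x : dotp a (k *: x) = k * dotp a x.
Proof. by rewrite dotpC dotpZl (dotpC a). Qed.

Lemma dotp0l x : dotp 0 x = 0.
Proof. by rewrite dotpE mul0mx mxE. Qed.

Lemma dotp0r a : dotp a 0 = 0.
Proof. by rewrite dotpC dotp0l. Qed.

Definition dotp_lin := (dotpDl, dotpDr, dotpNl, dotpNr, dotpZl, dotpZr).

Lemma dotp_sumr (I : finType) a (f : I -> 'rV[R]_n) :
  dotp a (\sum_i f i) = \sum_i dotp a (f i).
Proof. by elim/big_rec2 : _ => [|i x y _ <-]; rewrite ?dotp0r ?dotpDr. Qed.

Lemma dotp_delta (i : 'I_n) x : dotp (delta_mx 0 i) x = x 0 i.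
Proof.
rewrite /dotp (bigD1 i)//= big1 => [|j ji].
  by rewrite mxE !eqxx mul1r addr0.
by rewrite mxE (negbTE ji) andbF mul0r.
Qed.

Lemma dotp_continuous a : continuous (dotp a).
Proof.
apply: continuous_big => [|i _ x]; first exact: add_continuous.
apply: (@continuousM _ _ (fun=> a 0 i)); first exact: cst_continuous.
exact: coord_continuous.
Qed.

Lemma dotp_ge0 x : 0 <= dotp x x.
Proof. by apply: sumr_ge0 => i _; rewrite -expr2 sqr_ge0. Qed.

Lemma l2norm_ge0 x : 0 <= l2norm x.
Proof. exact: sqrtr_ge0. Qed.

Lemma sqr_l2norm x : l2norm x ^+ 2 = dotp x x.
Proof. by rewrite sqr_sqrtr// dotp_ge0. Qed.

Lemma dotp_eq0 x : dotp x x = 0 -> x = 0.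
Proof.
move=> /eqP; rewrite psumr_eq0 => [/allP x0|i _]; last by rewrite -expr2 sqr_ge0.
apply/rowP => i; have := x0 i; rewrite mem_index_enum mxE => /(_ isT)/=.
by rewrite mulf_eq0 orbb => /eqP.
Qed.

Lemma l2norm_eq0 x : l2norm x = 0 -> x = 0.
Proof. by move=> x0; apply: dotp_eq0; rewrite -sqr_l2norm x0 expr0n. Qed.

Lemma l2norm0 : l2norm (0 : 'rV[R]_n) = 0.
Proof. by rewrite /l2norm dotp0r sqrtr0. Qed.

Lemma l2norm_gt0 x : x != 0 -> 0 < l2norm x.
Proof.
by rewrite lt_neqAle l2norm_ge0 andbT; apply: contra => /eqP/esym/l2norm_eq0 ->.
Qed.

Lemma l2normZ (k : R) x : l2norm (k *: x) = `|k| * l2norm x.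
Proof.
by rewrite /l2norm !dotp_lin mulrA -expr2 sqrtrM ?sqr_ge0// sqrtr_sqr.
Qed.

Lemma l2normN x : l2norm (- x) = l2norm x.
Proof. by rewrite -scaleN1r l2normZ normrN1 mul1r. Qed.

Lemma l2norm_distC x y : l2norm (x - y) = l2norm (y - x).
Proof. by rewrite -l2normN opprB. Qed.

Lemma cauchy_schwarz a x : dotp a x <= l2norm a * l2norm x.
Proof.
have [->|x0] := eqVneq x 0; first by rewrite dotp0r l2norm0 mulr0.
apply: le_trans (ler_norm _) _.
rewrite -(@ler_pXn2r _ 2) ?nnegrE ?mulr_ge0 ?l2norm_ge0//.
rewrite exprMn !sqr_l2norm real_normK ?num_real//.
have xx0 : 0 < dotp x x by rewrite -sqr_l2norm exprn_gt0// l2norm_gt0.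
(* This vector is the component of a orthogonal to x, up to a factor. *)
have := dotp_ge0 (dotp x x *: a - dotp a x *: x).
set z := _ - _.
have -> : dotp z z = dotp x x * (dotp a a * dotp x x - dotp a x ^+ 2).
  by rewrite /z !dotp_lin (dotpC x a); ring.
by rewrite pmulr_rge0// subr_ge0.
Qed.

Lemma cauchy_schwarz_norm a x : `|dotp a x| <= l2norm a * l2norm x.
Proof.
rewrite ler_norml cauchy_schwarz andbT lerNl -dotpNl.
by rewrite -(l2normN a) cauchy_schwarz.
Qed.

Lemma l2norm_triangle x y : l2norm (x + y) <= l2norm x + l2norm y.
Proof.
rewrite -(@ler_pXn2r _ 2) ?nnegrE ?addr_ge0 ?l2norm_ge0//.
rewrite sqr_l2norm !dotp_lin sqrrD !sqr_l2norm (dotpC y x) addrA -(addrA (dotp x x)).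
by rewrite lerD2r lerD2l -mulr2n lerMn2r cauchy_schwarz orbT.
Qed.

Lemma coord_le_l2norm x i : `|x 0 i| <= l2norm x.
Proof.
rewrite -sqrtr_sqr ler_wsqrtr// /dotp (bigD1 i)//= expr2 lerDl.
by apply: sumr_ge0 => j _; rewrite -expr2 sqr_ge0.
Qed.

Lemma l2norm_le_sum x : l2norm x <= \sum_i `|x 0 i|.
Proof.
have -> : x = \sum_i x 0 i *: delta_mx 0 i by rewrite -row_sum_delta.
apply: (@le_trans _ _ (\sum_i l2norm (x 0 i *: delta_mx 0 i : 'rV[R]_n))).
  by elim/big_rec2 : _ => [|i y z _ le]; rewrite ?l2norm0//
    (le_trans (l2norm_triangle _ _))// lerD2l.
apply: ler_sum => i _; rewrite l2normZ.
rewrite -row_sum_delta.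
by rewrite /l2norm dotp_delta mxE !eqxx sqrtr1 mulr1.
Qed.

Lemma l2norm_le_coord x (e : R) :
  (forall i, `|x 0 i| <= e) -> l2norm x <= n%:R * e.
Proof.
move=> xe; apply: le_trans (l2norm_le_sum x) _.
rewrite mulr_natl -[n in leRHS]card_ord -sumr_const.
exact: ler_sum.
Qed.

Lemma l2norm_le_mx_norm x : l2norm x <= n%:R * `|x|.
Proof.
apply: l2norm_le_coord => i; rewrite [leRHS]/Num.norm/= mx_normrE.
by apply/bigmax_geP; right; exists (0, i).
Qed.

(** The parallelogram law for [x - c] and [x - d], whose half sum is the difference of
    [x] and the midpoint of [c] and [d]. *)
Lemma apollonius x c d :
  dotp (x - 2^-1 *: (c + d)) (x - 2^-1 *: (c + d)) =
  (dotp (x - c) (x - c) + dotp (x - d) (x - d)) / 2 - dotp (c - d) (c - d) / 4.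
Proof.
rewrite !dotp_lin (dotpC c x) (dotpC d x) (dotpC d c).
by field.
Qed.

End euclidean_space.

(** * Polytopes and their support functions *)

Section polytopes.
Context {R : realType} {n : nat}.
Implicit Types (a x y : 'rV[R]_n) (s : seq 'rV[R]_n) (P Q : set 'rV[R]_n).

Lemma mem_conv s x : x \in s -> conv s x.
Proof.
move=> xs; have xlt : (index x s < size s)%N by rewrite index_mem.
exists (fun i => (i == Ordinal xlt)%:R); split => [i||].
- exact: ler0n.
- by rewrite (bigD1 (Ordinal xlt))//= eqxx big1 ?addr0// => i /negbTE ->.
- rewrite (bigD1 (Ordinal xlt))//= eqxx scale1r nth_index// big1 ?addr0//.
  by move=> i /negbTE ->; rewrite scale0r.
Qed.

Lemma conv_dotp_le s a (m : R) :
  (forall x, x \in s -> dotp a x <= m) -> forall x, conv s x -> dotp a x <= m.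
Proof.
move=> sm _ [c [c0 c1 ->]]; rewrite dotp_sumr.
under eq_bigr do rewrite dotpZr.
rewrite -[m]mul1r -c1 mulr_suml; apply: ler_sum => i _.
by rewrite ler_wpM2l// sm// mem_nth.
Qed.

Lemma conv_convex s x y (t : R) : 0 <= t <= 1 -> conv s x -> conv s y ->
  conv s (x + t *: (y - x)).
Proof.
move=> /andP[t0 t1] [c [c0 c1 ->]] [d [d0 d1 ->]].
exists (fun i => c i + t * (d i - c i)); split => [i||].
- have -> : c i + t * (d i - c i) = (1 - t) * c i + t * d i by ring.
  by rewrite addr_ge0// mulr_ge0// subr_ge0.
- by rewrite big_split/= -mulr_sumr sumrB c1 d1 subrr mulr0 addr0.
- rewrite -sumrB scaler_sumr -big_split/=; apply: eq_bigr => i _.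
  by rewrite -scalerBl scalerA -scalerDl.
Qed.

(** The generators that have a positive weight in a maximizer of a linear functional are
    maximizers themselves.  This is applied to [a] on the polytope, and then to [b] on
    the face on which [a] is maximal. *)
Lemma face_generator s a b x : face (conv s) a x ->
    (forall y, face (conv s) a y -> dotp b y <= dotp b x) ->
  exists v, [/\ v \in s, face (conv s) a v & dotp b v = dotp b x].
Proof.
move=> [[c [c0 c1 xE]] xmax] xbmax.
have pos_eq (f : 'rV[R]_n) : (forall i, 0 < c i -> dotp f s`_i <= dotp f x) ->
    forall i, 0 < c i -> dotp f s`_i = dotp f x.
  move=> fle.
  have : \sum_i c i * (dotp f x - dotp f s`_i) = 0.
    under eq_bigr do rewrite mulrBr.
    rewrite sumrB -mulr_suml c1 mul1r {1}xE dotp_sumr.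
    by under eq_bigr do rewrite dotpZr; rewrite subrr.
  move/eqP; rewrite psumr_eq0 => [/allP h i ci|i _].
    have := h i; rewrite mem_index_enum => /(_ isT)/=.
    by rewrite mulf_eq0 gt_eqF//= subr_eq0 => /eqP.
  have := c0 i; rewrite le_eqVlt => /predU1P[<-|ci]; first by rewrite mul0r.
  by rewrite mulr_ge0 ?c0// subr_ge0 fle.
have gen (i : 'I_(size s)) : conv s s`_i := mem_conv (mem_nth 0 (ltn_ord i)).
have aeq := pos_eq a (fun i _ => xmax _ (gen i)).
have gface i : 0 < c i -> face (conv s) a s`_i.
  by move=> ci; split => // y sy; rewrite aeq// xmax.
have beq := pos_eq b (fun i ci => xbmax _ (gface i ci)).
have [i ci] : exists i, 0 < c i.
  apply: contrapT => /forallNP ncpos; move: c1; rewrite big1 => [/eqP|i _].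
    by rewrite eq_sym oner_eq0.
  by apply/eqP; rewrite eq_le c0 andbT leNgt; apply/negP/ncpos.
by exists s`_i; split; [exact/mem_nth|exact: gface|exact: beq].
Qed.

Lemma conv_max s a : s != [::] ->
  exists2 x, x \in s & forall y, conv s y -> dotp a y <= dotp a x.
Proof.
move=> s0; suff [x xs xmax] :
    exists2 x, x \in s & forall y, y \in s -> dotp a y <= dotp a x.
  by exists x => //; exact: conv_dotp_le.
elim: s s0 => [//|x [_ _|y s /(_ isT)[z zs zmax] _]].
  by exists x; rewrite ?mem_head// => y; rewrite inE => /eqP ->.
have [zx|xz] := leP (dotp a z) (dotp a x).
- exists x; first exact: mem_head.
  by move=> w; rewrite inE => /predU1P[->//|/zmax/le_trans]; exact.
- exists z; first by rewrite inE zs orbT.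
  by move=> w; rewrite inE => /predU1P[->|/zmax//]; exact: ltW.
Qed.

Lemma polytope_max P a : is_polytope P ->
  exists2 x, P x & forall y, P y -> dotp a y <= dotp a x.
Proof.
by move=> [s [s0 ->]]; have [x xs] := conv_max a s0; exists x => //; exact: mem_conv.
Qed.

Lemma polytope_nonempty P : is_polytope P -> P !=set0.
Proof. by move=> /(polytope_max 0)[x Px _]; exists x. Qed.

Lemma dotp_le_support P a x : is_polytope P -> P x -> dotp a x <= support_function P a.
Proof.
move=> /(polytope_max a)[y Py ymax] Px.
apply: ub_le_sup; last by exists x.
by exists (dotp a y) => _ [z Pz <-]; exact: ymax.
Qed.

Lemma support_le P a (m : R) : is_polytope P ->
  (forall x, P x -> dotp a x <= m) -> support_function P a <= m.
Proof.
move=> /polytope_nonempty[x Px] Pm; apply: ge_sup; first by exists (dotp a x), x.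
by move=> _ [y Py <-]; exact: Pm.
Qed.

Lemma support_eq P a x : P x -> (forall y, P y -> dotp a y <= dotp a x) ->
  support_function P a = dotp a x.
Proof.
move=> Px xmax; apply/le_anti/andP; split.
  by apply: ge_sup; [exists (dotp a x), x|move=> _ [y Py <-]; exact: xmax].
apply: ub_le_sup; last by exists x.
by exists (dotp a x) => _ [z Pz <-]; exact: xmax.
Qed.

Lemma supportP P a : is_polytope P -> exists2 x, P x & support_function P a = dotp a x.
Proof.
by move=> /(polytope_max a)[x Px xmax]; exists x => //; exact: support_eq.
Qed.

Lemma supportZ P a (k : R) : is_polytope P -> 0 <= k ->
  support_function P (k *: a) = k * support_function P a.
Proof.
move=> /(polytope_max a)[x Px xmax] k0.
rewrite (support_eq Px xmax) -dotpZl; apply: support_eq => // y Py.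
by rewrite !dotpZl ler_wpM2l// xmax.
Qed.

Lemma support0 P : is_polytope P -> support_function P 0 = 0.
Proof. by move=> pP; rewrite -[0](scale0r 0) supportZ// mul0r. Qed.

Lemma polytope_bounded P : is_polytope P ->
  exists2 M : R, 0 < M & forall x, P x -> l2norm x <= M.
Proof.
move=> pP.
pose m := \sum_i (`|support_function P (delta_mx 0 i)| +
  `|support_function P (- delta_mx 0 i)|).
exists (n%:R * m + 1).
  by rewrite ltr_wpDl// mulr_ge0// sumr_ge0// => i _; rewrite addr_ge0.
move=> x Px; rewrite ler_wpDr//; apply: l2norm_le_coord => i.
apply: (@le_trans _ _ (`|support_function P (delta_mx 0 i)| +
    `|support_function P (- delta_mx 0 i)|)).
  rewrite -dotp_delta ler_norml lerNl -dotpNl.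
  have := dotp_le_support (delta_mx 0 i) pP Px.
  have := dotp_le_support (- delta_mx 0 i) pP Px.
  have := ler_norm (support_function P (delta_mx 0 i)).
  have := ler_norm (support_function P (- delta_mx 0 i)).
  have := normr_ge0 (support_function P (delta_mx 0 i)).
  have := normr_ge0 (support_function P (- delta_mx 0 i)).
  by move=> *; apply/andP; split; lra.
rewrite /m (bigD1 i)//= lerDl.
by apply: sumr_ge0 => j _; rewrite addr_ge0.
Qed.

(** A polytope is the image of the standard simplex, which is closed and bounded. *)
Lemma polytope_compact P : is_polytope P -> compact P.
Proof.
move=> [s [_ ->]].
pose simplex := [set c : 'rV[R]_(size s) |
  (forall i, 0 <= c 0 i) /\ \sum_i c 0 i = 1].
pose f (c : 'rV[R]_(size s)) := \sum_i c 0 i *: s`_i.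
have -> : conv s = f @` simplex.
  apply/seteqP; split => [_ [c [c0 c1 ->]]|_ [c [c0 c1] <-]].
    exists (\row_i c i); first split=> [i|]; first by rewrite mxE.
      by rewrite -c1; apply: eq_bigr => i _; rewrite mxE.
    by apply: eq_bigr => i _; rewrite mxE.
  by exists (c 0).
apply: continuous_compact.
  apply: continuous_subspaceT; apply: continuous_big => [|i _ c].
    exact: add_continuous.
  apply: continuousZl; exact: coord_continuous.
apply: bounded_closed_compact.
  exists 1; split => // M M1 c [c0 c1]; apply: le_trans (ltW M1).
  rewrite [leLHS]/Num.norm/= mx_normrE; apply/bigmax_leP; split => // -[i j] _/=.
  rewrite ord1 ger0_norm// -c1 (bigD1 j)//= lerDl.
  by apply: sumr_ge0.
have -> : simplex = \bigcap_i [set c : 'rV[R]_(size s) | 0 <= c 0 i] `&`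
    [set c | \sum_i c 0 i = 1].
  apply/seteqP; split => [c [c0 c1]|c [c0 c1]]; split => // i; last exact: c0.
  by move=> _; exact: c0.
apply: closedI.
  apply: closed_bigI => i _.
  apply: (@closed_comp _ _ (fun c : 'rV[R]_(size s) => c 0 i) [set x | 0 <= x]).
    by move=> c _; exact: coord_continuous.
  exact: closed_ge.
apply: (@closed_comp _ _ (fun c : 'rV[R]_(size s) => \sum_i c 0 i) [set x | x = 1]).
  move=> c _; apply: continuous_big => [|i _]; first exact: add_continuous.
  exact: coord_continuous.
exact: closed_eq.
Qed.

Lemma sub_dotp_continuous x : continuous (fun y => dotp (x - y) (x - y)).
Proof.
apply: continuous_big => [|i _ y]; first exact: add_continuous.
have h : {for y, continuous (fun y => (x - y) 0 i)}.
  apply: (@continuous_comp _ _ _ (fun y => x - y) (fun z : 'rV[R]_n => z 0 i)).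
    by apply: continuousB; [exact: cst_continuous|].
  exact: coord_continuous.
exact: continuousM.
Qed.

(** A point of [P] at minimal distance from [x] exists by compactness.  If some [y] made
    the product positive, a small step from this point towards [y] would come closer to
    [x]. *)
Lemma nearest_point P x : is_polytope P ->
  exists2 p, P p & forall y, P y -> dotp (x - p) (y - p) <= 0.
Proof.
move=> pP.
have [p] := EVT_min_rV (polytope_nonempty pP) (polytope_compact pP)
  (continuous_subspaceT (@sub_dotp_continuous x)).
rewrite inE => Pp pmin; exists p => // y Py.
rewrite leNgt; apply/negP => pos.
have convexP (t : R) : 0 <= t <= 1 -> P (p + t *: (y - p)).
  by move: pP Pp Py => [s [_ ->]] sp sy t01; exact: conv_convex.
set u := dotp _ _ in pos; set v := dotp (y - p) (y - p).
have v0 : 0 <= v by exact: dotp_ge0.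
(* A step t decreases the squared distance to x by t * (2 * u - t * v). *)
pose t := u / (u + v).
have uv0 : 0 < u + v by lra.
have t01 : 0 <= t <= 1.
  by rewrite /t ler_pdivrMr// divr_ge0 ?(ltW pos) ?(ltW uv0)//= mul1r; lra.
have := pmin _ (mem_set (convexP t t01)).
have -> : x - (p + t *: (y - p)) = (x - p) - t *: (y - p) by rewrite opprD addrA.
have -> : dotp (x - p - t *: (y - p)) (x - p - t *: (y - p)) =
    dotp (x - p) (x - p) - t * (2 * u - t * v).
  have -> : dotp (x - p - t *: (y - p)) (x - p - t *: (y - p)) =
      dotp (x - p) (x - p) - t * dotp (x - p) (y - p) - t * dotp (y - p) (x - p)
      + t * t * dotp (y - p) (y - p).
    by move: (x - p) (y - p) => X Y; rewrite !dotp_lin; ring.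
  by rewrite (dotpC (y - p)) -/u -/v; ring.
rewrite lerBrDl -subr_le0 addrK; apply/negP; rewrite -ltNge.
have t0 : 0 < t by rewrite divr_gt0.
apply: mulr_gt0 => //.
have tuv : t * (u + v) = u by rewrite /t divfK// gt_eqF.
have : 0 < t * u by rewrite mulr_gt0.
rewrite mulrDr in tuv; lra.
Qed.

Lemma support_nearest P x p : P p -> (forall y, P y -> dotp (x - p) (y - p) <= 0) ->
  support_function P (x - p) = dotp (x - p) p.
Proof.
move=> Pp sep; apply: support_eq => // y Py.
by have := sep y Py; rewrite dotpDr dotpNr subr_le0.
Qed.

End polytopes.

(** * The uniform distance of support functions *)

Section support_distance.
Context {R : realType} {n : nat}.
Implicit Types (a x y : 'rV[R]_n) (P Q : set 'rV[R]_n) (e : R).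

(** By convex duality, this says that the Hausdorff distance of [P] and [Q] is at most
    [e]. *)
Definition support_close e P Q :=
  forall a, `|support_function P a - support_function Q a| <= e * l2norm a.

Lemma support_closeC e P Q : support_close e P Q -> support_close e Q P.
Proof. by move=> PQ a; rewrite distrC. Qed.

(** With [y] the point of [Q] nearest to [x], the functional [x - y] attains its maximum
    over [Q] at [y], and exceeds it at [x] by the squared distance. *)
Lemma support_close_near e P Q x : 0 <= e -> is_polytope P -> is_polytope Q ->
  support_close e P Q -> P x -> exists2 y, Q y & l2norm (x - y) <= e.
Proof.
move=> e0 pP pQ PQ Px; have [y Qy ynear] := nearest_point x pQ; exists y => //.
have [->|xy] := eqVneq (x - y) 0; first by rewrite l2norm0.
rewrite -(ler_pM2r (l2norm_gt0 xy)) -expr2 sqr_l2norm dotpDr dotpNr.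
rewrite -(support_nearest Qy ynear) lerBlDl.
apply: (le_trans (dotp_le_support _ pP Px)).
by rewrite -lerBlDl; apply: le_trans (ler_norm _) (PQ _).
Qed.

Lemma dist_le x y P : P y -> dist x P <= l2norm (x - y).
Proof.
move=> Py; apply: ge_inf; last by exists y.
by exists 0 => _ [z _ <-]; exact: l2norm_ge0.
Qed.

Lemma hausdorff_dist_le e P Q : 0 <= e -> is_polytope P -> is_polytope Q ->
  support_close e P Q -> hausdorff_dist P Q <= e.
Proof.
move=> e0; suff half (A B : set 'rV[R]_n) : is_polytope A -> is_polytope B -> support_close e A B ->
    sup [set dist x B | x in A] <= e.
  by move=> pP pQ PQ; rewrite /hausdorff_dist ge_max !half//; exact: support_closeC.
move=> pA pB AB; apply: ge_sup.
  by have [x Ax] := polytope_nonempty pA; exists (dist x B), x.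
move=> _ [x Ax <-]; have [y By xy] := support_close_near e0 pA pB AB Ax.
exact: le_trans (dist_le _ By) xy.
Qed.

Lemma unit_cell (K : nat) (x : R) : 0 <= x <= K.+1%:R ->
  exists k : 'I_K.+1, k%:R <= x <= k%:R + 1.
Proof.
elim: K => [|K IH] /andP[x0 xK].
  by exists ord0; rewrite x0 add0r.
have [xk|kx] := leP x K.+1%:R.
  have [k kP] := IH (introT andP (conj x0 xk)).
  by exists (widen_ord (leqnSn _) k).
by exists ord_max => /=; rewrite (ltW kx)/= natr1.
Qed.

Lemma interval_cell (K : nat) (M x : R) : 0 < M -> `|x| <= M ->
  exists k : 'I_K.+1, - M + k%:R * (2 * M / K.+1%:R) <= x <=
    - M + k%:R * (2 * M / K.+1%:R) + 2 * M / K.+1%:R.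
Proof.
move=> M0; rewrite ler_norml => /andP[Mx xM].
set w := 2 * M / _; have w0 : 0 < w by rewrite divr_gt0// mulr_gt0.
have [|k /andP[k1 k2]] := @unit_cell K ((x + M) / w).
  rewrite divr_ge0 ?(ltW w0)//=; last by lra.
  rewrite ler_pdivrMr// /w mulrCA divff// mulr1; lra.
exists k; move: k1 k2; rewrite ler_pdivlMr// ler_pdivrMr// mulrDl mul1r => k1 k2.
by apply/andP; split; lra.
Qed.

Lemma support_lipschitz P (B : R) a b : is_polytope P ->
  (forall x, P x -> l2norm x <= B) ->
  `|support_function P a - support_function P b| <= l2norm (a - b) * B.
Proof.
move=> pP PB; suff half u v :
    support_function P u - support_function P v <= l2norm (u - v) * B.
  by rewrite ler_norml half andbT lerNl opprB l2norm_distC half.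
rewrite lerBlDl; apply: support_le => // x Px.
have -> : dotp u x = dotp v x + dotp (u - v) x.
  by rewrite dotpDl dotpNl addrCA subrr addr0.
rewrite lerD ?dotp_le_support//.
by apply: le_trans (cauchy_schwarz _ _) _; rewrite ler_wpM2l ?l2norm_ge0 ?PB.
Qed.

(** Support functions are Lipschitz with a constant bounding the polytope, and the
    values in the coordinate directions bound the polytope.  So a finite net of
    directions determines them up to a small error, and pointwise convergence of
    support functions of polytopes is uniform on the unit sphere. *)
Lemma support_close_net P e : is_polytope P -> 0 < e ->
  exists (L : seq 'rV[R]_n) (d : R), 0 < d /\
    forall Q, is_polytope Q ->
      (forall a, a \in L -> `|support_function P a - support_function Q a| <= d) ->
      support_close e P Q.
Proof.
move=> pP e0; have [M M0 PM] := polytope_bounded pP.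
pose B := n%:R * (M + 1) + M.
have B0 : 0 < B by rewrite /B ltr_wpDl// mulr_ge0//; lra.
have PB x : P x -> l2norm x <= B.
  by move=> /PM/le_trans; apply; rewrite /B ler_wpDl// mulr_ge0//; lra.
pose K := Num.truncn (8 * B * n%:R / e).
pose w : R := 2 / K.+1%:R.
have w0 : 0 < w by rewrite divr_gt0.
have wK : 2 * (n%:R * w * B) <= e / 2.
  have : 8 * B * n%:R / e < K.+1%:R by exact: truncnS_gt.
  rewrite ltr_pdivrMr// => /ltW leK.
  rewrite /w -(ler_pM2r (_ : 0 < K.+1%:R :> R))//.
  have -> : 2 * (n%:R * (2 / K.+1%:R) * B) * K.+1%:R = 4 * B * n%:R by field.
  by lra.
pose grid (f : {ffun 'I_n -> 'I_K.+1}) : 'rV[R]_n := \row_i (- 1 + (f i)%:R * w).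
exists ([seq delta_mx 0 i | i <- enum 'I_n] ++ [seq - delta_mx 0 i | i <- enum 'I_n]
  ++ [seq grid f | f <- enum {ffun 'I_n -> 'I_K.+1}]), (Num.min 1 (e / 2)).
split; first by rewrite lt_min ltr01 divr_gt0.
move=> Q pQ PQ.
have PQ1 a : a \in [seq delta_mx 0 i | i <- enum 'I_n] ++
    [seq - delta_mx 0 i | i <- enum 'I_n] -> l2norm a <= 1 ->
    support_function Q a <= M + 1.
  move=> aL a1; have := PQ a; rewrite catA mem_cat aL => /(_ isT).
  rewrite le_min => /andP[+ _]; rewrite distrC => /(le_trans (ler_norm _)).
  have : support_function P a <= M.
    apply: support_le => // x Px; apply: le_trans (cauchy_schwarz _ _) _.
    by rewrite -[M]mul1r ler_pM ?l2norm_ge0 ?PM.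
  by move=> *; lra.
have norm_delta i : l2norm (delta_mx 0 i : 'rV[R]_n) <= 1.
  by rewrite /l2norm dotp_delta mxE !eqxx sqrtr1.
have QB x : Q x -> l2norm x <= B.
  move=> Qx; rewrite /B ler_wpDr ?(ltW M0)//; apply: l2norm_le_coord => i.
  rewrite ler_norml lerNl -dotp_delta -dotpNl; apply/andP; split.
    apply: le_trans (dotp_le_support _ pQ Qx) (PQ1 _ _ _); last by rewrite l2normN.
    by rewrite mem_cat (map_f (fun i => - delta_mx 0 i)) ?orbT// mem_enum.
  apply: le_trans (dotp_le_support _ pQ Qx) (PQ1 _ _ _); last exact: norm_delta.
  by rewrite mem_cat (map_f (delta_mx 0))// mem_enum.
move=> a; have [->|a0] := eqVneq a 0.
  by rewrite !support0// subrr normr0 l2norm0 mulr0.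
have na0 := l2norm_gt0 a0.
pose u := (l2norm a)^-1 *: a.
have aE : a = l2norm a *: u by rewrite /u scalerA divff ?gt_eqF// scale1r.
have u1 : l2norm u = 1.
  by rewrite /u l2normZ ger0_norm ?invr_ge0 ?l2norm_ge0// mulVf// gt_eqF.
clearbody u.
suff uPQ : `|support_function P u - support_function Q u| <= e.
  rewrite {1 2}aE !supportZ ?l2norm_ge0// -mulrBr normrM (ger0_norm (l2norm_ge0 _)).
  by rewrite mulrC ler_wpM2r// l2norm_ge0.
have /choice[f fP] (i : 'I_n) : exists k : 'I_K.+1,
    - 1 + k%:R * w <= u 0 i <= - 1 + k%:R * w + w.
  have /interval_cell : `|u 0 i| <= 1 by rewrite -u1 coord_le_l2norm.
  by move=> /(_ K ltr01); rewrite mulr1.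
pose g := grid (finfun f).
have ug : l2norm (u - g) <= n%:R * w.
  apply: l2norm_le_coord => i; rewrite !mxE ffunE ler_norml.
  by have /andP[? ?] := fP i; have := ltW w0 => ?; apply/andP; split; lra.
have lip A : is_polytope A -> (forall x, A x -> l2norm x <= B) ->
    `|support_function A u - support_function A g| <= n%:R * w * B.
  move=> pA AB; apply: le_trans (support_lipschitz _ _ pA AB) _.
  by rewrite ler_wpM2r ?(ltW B0).
have gPQ : `|support_function P g - support_function Q g| <= e / 2.
  have := PQ g; rewrite !mem_cat (map_f grid) ?mem_enum// !orbT => /(_ isT).
  by rewrite le_min => /andP[].
have := lip _ pP PB; have := lip _ pQ QB; move: gPQ wK.
rewrite !ler_norml => gPQ wK /andP[? ?] /andP[? ?]; move/andP : gPQ => [? ?].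
by apply/andP; split; lra.
Qed.

End support_distance.

(** * Smallest enclosing balls *)

Section smallest_enclosing_ball.
Context {R : realType} {n : nat}.
Implicit Types (x y c d : 'rV[R]_n) (P Q : set 'rV[R]_n) (r s : R).

Definition reach P c := sup [set l2norm (x - c) | x in P].

Lemma le_reach P c x : is_polytope P -> P x -> l2norm (x - c) <= reach P c.
Proof.
move=> pP Px; apply: ub_le_sup; last by exists x.
have [M _ PM] := polytope_bounded pP; exists (M + l2norm c) => _ [y Py <-].
by apply: le_trans (l2norm_triangle _ _) _; rewrite l2normN lerD2r PM.
Qed.

Lemma reach_le P c r : is_polytope P -> P `<=` closed_ball2 c r -> reach P c <= r.
Proof.
move=> pP Pr; apply: ge_sup.
  by have [x Px] := polytope_nonempty pP; exists (l2norm (x - c)), x.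
by move=> _ [x /Pr + <-].
Qed.

Lemma reach_lipschitz P c d : is_polytope P -> reach P c <= reach P d + l2norm (c - d).
Proof.
move=> pP; apply: reach_le => // x Px; rewrite /closed_ball2/=.
have -> : x - c = (x - d) + (d - c) by rewrite addrA subrK.
apply: le_trans (l2norm_triangle _ _) _.
by rewrite (l2norm_distC d) lerD2r le_reach.
Qed.

Lemma reach_continuous P : is_polytope P -> continuous (reach P).
Proof.
move=> pP c A /nbhs_ballP[e /= e0 eA].
have n0 : 0 < n%:R + 1 :> R by rewrite ltr_wpDl.
apply/nbhs_ballP; exists (e / (n%:R + 1)); first exact: divr_gt0.
move=> d; rewrite -ball_normE /ball_/= ltr_pdivlMr// => cd.
apply: eA; rewrite -ball_normE /ball_/=; apply: (@le_lt_trans _ _ (l2norm (c - d))).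
  rewrite ler_norml lerNl opprB !lerBlDl.
  by rewrite [leRHS]addrC [in leRHS]l2norm_distC !reach_lipschitz//=;
    rewrite addrC reach_lipschitz.
apply: le_lt_trans (l2norm_le_mx_norm _) _; apply: le_lt_trans cd.
by rewrite mulrC ler_wpM2l// lerDl.
Qed.

(** The distance to the farthest point of [P] does not increase when a centre is moved to
    the point of [P] nearest to it, so it suffices to minimize it over the compact
    set [P]. *)
Lemma smallest_ball_exists P : is_polytope P -> exists cr, smallest_ball P cr.
Proof.
move=> pP.
have [c] := EVT_min_rV (polytope_nonempty pP) (polytope_compact pP)
  (continuous_subspaceT (reach_continuous pP)).
rewrite inE => Pc cmin; exists (c, reach P c); split => /=.
- exact: le_trans (l2norm_ge0 _) (le_reach _ pP Pc).
- by move=> x Px; exact: le_reach.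
- move=> d r r0 Pr; have [p Pp pnear] := nearest_point d pP.
  apply: le_trans (cmin p (mem_set Pp)) _; apply: reach_le => // x Px.
  apply: le_trans (Pr _ Px); rewrite /l2norm ler_wsqrtr//.
  have -> : x - d = (x - p) - (d - p) by rewrite opprB addrA subrK.
  move: (pnear _ Px) (dotp_ge0 (d - p)); move: (d - p) (x - p) => u v.
  by rewrite !dotp_lin (dotpC v u) => *; lra.
Qed.

Lemma smallest_ballP P : is_polytope P -> smallest_ball P (center P, radius P).
Proof.
move=> /smallest_ball_exists/getPex.
by rewrite /center /radius; case: get.
Qed.

(** By [apollonius], a ball about the midpoint of two centres can be taken smaller by an
    amount that grows with their distance. *)
Lemma smallest_ball_stable P c r d s : is_polytope P ->
  smallest_ball P (c, r) -> P `<=` closed_ball2 d s ->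
  dotp (c - d) (c - d) <= 2 * (s ^+ 2 - r ^+ 2).
Proof.
move=> pP [/= r0 Pr rmin] Ps.
pose q := (r ^+ 2 + s ^+ 2) / 2 - dotp (c - d) (c - d) / 4.
have Pq x : P x -> dotp (x - 2^-1 *: (c + d)) (x - 2^-1 *: (c + d)) <= q.
  move=> Px; rewrite apollonius /q lerD2r ler_pM2r// -!sqr_l2norm.
  have := Pr _ Px; have := Ps _ Px; rewrite /closed_ball2/= => xs xr.
  have s0 := le_trans (l2norm_ge0 _) xs.
  by rewrite lerD// lerXn2r ?nnegrE ?l2norm_ge0.
have q0 : 0 <= q.
  by have [x /Pq] := polytope_nonempty pP; apply: le_trans; exact: dotp_ge0.
have : r <= Num.sqrt q.
  apply: (rmin (2^-1 *: (c + d))); first exact: sqrtr_ge0.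
  by move=> x /Pq; rewrite /closed_ball2/= /l2norm => ?; exact: ler_wsqrtr.
rewrite -(@ler_pXn2r _ 2) ?nnegrE ?sqrtr_ge0// sqr_sqrtr// /q.
by set z := dotp _ _; lra.
Qed.

Lemma smallest_ball_unique P cr : is_polytope P -> smallest_ball P cr ->
  cr = (center P, radius P).
Proof.
case: cr => c r pP scr; have scr' := smallest_ballP pP.
have [/= r0 Pr rmin] := scr; have [/= r0' Pr' rmin'] := scr'.
have rr' : r = radius P.
  by apply/le_anti; rewrite (rmin (center P))//= (rmin' c).
congr pair => //; apply/eqP; rewrite -subr_eq0; apply/eqP/dotp_eq0/le_anti.
rewrite dotp_ge0 andbT; apply: le_trans (smallest_ball_stable pP scr Pr') _.
by rewrite rr' subrr mulr0.
Qed.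

Lemma radius_ge0 P : is_polytope P -> 0 <= radius P.
Proof. by move=> /smallest_ballP[]. Qed.

Lemma sub_enclosing_ball P : is_polytope P -> P `<=` closed_ball2 (center P) (radius P).
Proof. by move=> /smallest_ballP[]. Qed.

Lemma radius_gt0 P : is_polytope P -> ~ is_point P -> 0 < radius P.
Proof.
move=> pP notpt; rewrite lt_neqAle radius_ge0// andbT; apply/eqP => r0.
have Pc x : P x -> x = center P.
  move=> /(sub_enclosing_ball pP); rewrite /closed_ball2/= -r0 => xc.
  apply/eqP; rewrite -subr_eq0; apply/eqP/l2norm_eq0/le_anti.
  by rewrite xc l2norm_ge0.
have [x Px] := polytope_nonempty pP.
apply: notpt; exists (center P); apply/seteqP; split => y; first exact: Pc.
by move=> ->; rewrite -(Pc x).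
Qed.

Lemma closed_ball2_near e P Q c r : 0 <= e -> is_polytope P -> is_polytope Q ->
  support_close e P Q -> Q `<=` closed_ball2 c r -> P `<=` closed_ball2 c (r + e).
Proof.
move=> e0 pP pQ PQ Qr x Px; have [y Qy xy] := support_close_near e0 pP pQ PQ Px.
rewrite /closed_ball2/=.
have -> : x - c = (y - c) + (x - y) by rewrite [RHS]addrC addrA subrK.
by apply: le_trans (l2norm_triangle _ _) _; rewrite lerD// Qr.
Qed.

Lemma radius_close e P Q : 0 <= e -> is_polytope P -> is_polytope Q ->
  support_close e P Q -> `|radius P - radius Q| <= e.
Proof.
move=> e0; suff half (A B : set 'rV[R]_n) : is_polytope A -> is_polytope B -> support_close e A B ->
    radius A <= radius B + e.
  move=> pP pQ PQ; rewrite ler_norml lerNl opprB !lerBlDl !half//.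
  exact: support_closeC.
move=> pA pB AB; have [_ _ /(_ (center B))] := smallest_ballP pA; apply.
  by rewrite addr_ge0// radius_ge0.
exact: closed_ball2_near AB (sub_enclosing_ball pB).
Qed.

Lemma center_close e P Q : 0 <= e -> is_polytope P -> is_polytope Q ->
  support_close e P Q ->
  l2norm (center P - center Q) ^+ 2 <= 8 * e * (radius P + e).
Proof.
move=> e0 pP pQ PQ; rewrite sqr_l2norm.
apply: le_trans (smallest_ball_stable pP (smallest_ballP pP)
  (closed_ball2_near e0 pP pQ PQ (sub_enclosing_ball pQ))) _.
have := radius_close e0 pP pQ PQ; rewrite distrC => /(le_trans (ler_norm _)).
have := radius_ge0 pP; have := radius_ge0 pQ.
move: (radius P) (radius Q) => p q q0 p0 qp.
have : (q + e) ^+ 2 <= (p + 2 * e) ^+ 2 by rewrite lerXn2r ?nnegrE; lra.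
nra.
Qed.

End smallest_enclosing_ball.

(** * The volume of thin shells *)

Section volume.
Context {R : realType} {n : nat}.
Hypothesis n_gt0 : (0 < n)%N.
Implicit Types (x y : 'rV[R]_n) (Q X : set 'rV[R]_n).

(** A finite cover becomes a countable one by adding boxes reduced to the origin, which
    have volume zero because the dimension is positive. *)
Lemma vol_le_boxes (I : finType) (a b : I -> 'rV[R]_n) X :
  (forall i j, a i 0 j <= b i 0 j) -> X `<=` \bigcup_i box (a i) (b i) ->
  (vol X <= (\sum_i \prod_j (b i 0 j - a i 0 j))%:E)%E.
Proof.
move=> ab Xab; pose seqOf (c : I -> 'rV[R]_n) k :=
  if insub k is Some o then c (enum_val (o : 'I_#|I|)) else 0.
apply: ereal_inf_lbound; exists (seqOf a), (seqOf b); split.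
- by move=> k i; rewrite /seqOf; case: insubP => [u _ _|_]; [exact: ab|].
- move=> x /Xab[i _ xi]; exists (enum_rank i) => //.
  by rewrite /seqOf valK enum_rankK.
- rewrite (nneseries_split _ #|I|) ?add0n; last first.
    move=> k _; rewrite lee_fin prodr_ge0// => i _; rewrite subr_ge0 /seqOf.
    by case: insubP => [u _ _|_]; [exact: ab|].
  rewrite [X in (_ + X)%E]eseries0 ?adde0; last first.
    move=> k Ik _; rewrite /seqOf insubF ?ltnNge ?Ik//.
    by rewrite (bigD1 (Ordinal n_gt0))//= subrr mul0r.
  rewrite big_mkord sumEFin; congr _%:E.
  rewrite (reindex_onto (@enum_val I predT) enum_rank)/=; last first.
    by move=> i _; exact: enum_rankK.
  rewrite (eq_bigl predT) => [|o]; last by rewrite enum_valK eqxx.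
  by apply: eq_bigr => o _; rewrite /seqOf valK.
Qed.

Section shell.
Variables (Q X : set 'rV[R]_n) (M d : R) (K : nat).
Hypotheses (pQ : is_polytope Q) (M0 : 0 < M).
Let w := 2 * M / K.+1%:R.
Hypothesis dw : d <= w.
Hypothesis Xbounded : forall x, X x -> l2norm x <= M.
Hypothesis XQ : forall x, X x -> ~ Q x /\ exists2 y, Q y & l2norm (x - y) <= d.

Let w0 : 0 < w. Proof. by rewrite divr_gt0// mulr_gt0. Qed.

Let cell (k : nat) : R := - M + k%:R * w.

(** On a patch the outer normal of the shell stays away from the hyperplane orthogonal to
    the i-th axis: its i-th coordinate dominates the others and has the sign given by
    [b].  The function [f] codes a column of cells parallel to the i-th axis; its value
    at [i] is fixed so that each column has one code. *)
Let patch (i : 'I_n) (b : bool) (f : {ffun 'I_n -> 'I_K.+1}) : set 'rV[R]_n :=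
  [set x | [/\ X x, f i = ord0, forall j, j != i -> cell (f j) <= x 0 j <= cell (f j) + w &
    exists p, [/\ x - p != 0, forall y, Q y -> dotp (x - p) (y - p) <= 0 &
      forall j, `|(x - p) 0 j| <= (-1) ^+ b * (x - p) 0 i]]].

(** At a point [x] of the patch, [Q] lies behind the hyperplane through [x] orthogonal to
    the outer normal.  So another point of the patch, being close to [Q], cannot be far
    beyond [x] in the direction of the i-th axis. *)
Let patch_half i b f x x' : patch i b f x -> patch i b f x' ->
  (-1) ^+ b * (x' 0 i - x 0 i) <= 2 * n%:R * w.
Proof.
move=> [_ _ xf [p [xp psep pdom]]] [Xx' _ xf' _].
have [_ [y Qy xy]] := XQ Xx'.
set m := (-1) ^+ b * (x - p) 0 i in pdom.
have m0 : 0 < m.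
  rewrite lt_neqAle (le_trans _ (pdom i))// andbT; apply/negP => /eqP m0.
  move/eqP: xp; apply; apply/rowP => j; rewrite [RHS]mxE; apply/eqP.
  by rewrite -normr_le0 m0 pdom.
have normd : l2norm (x - p) <= n%:R * m by exact: l2norm_le_coord.
have upper : dotp (x - p) (x' - x) <= n%:R * m * w.
  have -> : x' - x = (x' - y) + ((y - p) - (x - p)).
    by apply/rowP => k; rewrite !mxE; ring.
  rewrite dotpDr [dotp _ (y - p - _)]dotpDr dotpNr.
  apply: (@le_trans _ _ (dotp (x - p) (x' - y))).
    by rewrite gerDl; have := psep _ Qy; have := dotp_ge0 (x - p); lra.
  apply: le_trans (cauchy_schwarz _ _) _.
  by rewrite ler_pM ?l2norm_ge0// (le_trans xy).
have lower : m * ((-1) ^+ b * (x' 0 i - x 0 i)) - n%:R * m * w <= dotp (x - p) (x' - x).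
  rewrite /dotp (bigD1 i)//=.
  have -> : m * ((-1) ^+ b * (x' 0 i - x 0 i)) = (x - p) 0 i * (x' - x) 0 i.
    have -> : (x' - x) 0 i = x' 0 i - x 0 i by rewrite !mxE.
    by rewrite /m; move: ((x - p) 0 i) => z; case: (b); rewrite ?expr1 ?expr0; ring.
  rewrite lerD2l lerNl -sumrN.
  apply: (@le_trans _ _ (\sum_(j < n | j != i) (m * w))).
    apply: ler_sum => j ji; rewrite -mulrN; apply: le_trans (ler_norm _) _.
    rewrite normrM normrN ler_pM// mxE mxE ler_norml.
    by have /andP[? ?] := xf _ ji; have /andP[? ?] := xf' _ ji; apply/andP; split; lra.
  rewrite sumr_const -[leRHS]mulrA -[leLHS]mulr_natl.
  apply: ler_wpM2r; first by rewrite mulr_ge0 ?(ltW m0) ?(ltW w0).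
  by rewrite ler_nat (leq_trans (max_card _))// card_ord.
rewrite -(ler_pM2l m0); have := le_trans lower upper; lra.
Qed.

Let patch_width i b f x x' : patch i b f x -> patch i b f x' ->
  `|x' 0 i - x 0 i| <= 2 * n%:R * w.
Proof.
move=> px px'; have := patch_half px px'; have := patch_half px' px.
by case: b {px px'}; rewrite ?expr1 ?expr0 => ? ?;
  rewrite ler_norml; apply/andP; split; lra.
Qed.

(** Each patch fits in a box over its column of height proportional to [w], and there are
    [(2 * M / w) ^ (n - 1)] columns.  The total volume of the boxes is computed as
    a sum of products over all codes, in which the codes with a nonzero value at [i]
    contribute boxes of height zero, and this sum factors as a product of sums. *)
Lemma vol_shell : (vol X <= (8 * n%:R ^+ 2 * w * (2 * M) ^+ n.-1)%:E)%E.
Proof.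
pose I : finType := (('I_n * bool) * {ffun 'I_n -> 'I_K.+1})%type.
pose side (i j : 'I_n) (k : 'I_K.+1) : R :=
  if j == i then (if k == ord0 then 4 * n%:R * w else 0) else w.
have side0 i j k : 0 <= side i j k.
  rewrite /side; case: ifP => _; last exact: ltW.
  by case: ifP => // _; rewrite !mulr_ge0// ltW.
pose corner (t : I) : 'rV[R]_n := \row_j if j == t.1.1 then
  (get (patch t.1.1 t.1.2 t.2) : 'rV[R]_n) 0 j - 2 * n%:R * w else cell (t.2 j).
pose far (t : I) : 'rV[R]_n := corner t + \row_j side t.1.1 j (t.2 j).
have -> : 8 * n%:R ^+ 2 * w * (2 * M) ^+ n.-1 =
    \sum_t \prod_j (far t 0 j - corner t 0 j).
  under eq_bigr => t _ do under eq_bigr => j _ do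
    rewrite [far t 0 j]mxE addrAC subrr add0r mxE.
  rewrite -(pair_bigA _ (fun (u : 'I_n * bool) (f : {ffun 'I_n -> 'I_K.+1}) =>
    \prod_j side u.1 j (f j)))/=.
  under eq_bigr => u _ do rewrite -(bigA_distr_bigA (side u.1)).
  have prodE (u : 'I_n * bool) : \prod_j \sum_k side u.1 j k =
      4 * n%:R * w * (2 * M) ^+ n.-1.
    rewrite (bigD1 u.1)//= /side eqxx (bigD1 ord0)//= [X in _ + X]big1 ?addr0.
      congr (_ * _); under eq_bigr => j /negbTE ji do rewrite ji.
      rewrite sumr_const card_ord prodr_const cardC1 card_ord.
      by rewrite -[w *+ _]mulr_natr /w divfK// pnatr_eq0.
    by move=> k /negbTE ->.
  rewrite (eq_bigr _ (fun u _ => prodE u)) sumr_const card_prod card_bool card_ord.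
  by rewrite -[RHS]mulr_natr natrM; ring.
apply: vol_le_boxes => [t j|x Xx]; first by rewrite [leRHS]mxE lerDl mxE.
have [nQx _] := XQ Xx; have [p Qp psep] := nearest_point x pQ.
have xp : x - p != 0.
  by apply/negP; rewrite subr_eq0 => /eqP xp; apply: nQx; rewrite xp.
pose i := [arg max_(i > Ordinal n_gt0) `|(x - p) 0 i|]%O.
have imax j : `|(x - p) 0 j| <= `|(x - p) 0 i|.
  by rewrite /i; case: arg_maxP => // k _; exact.
pose b := (x - p) 0 i < 0.
have /choice[f fP] (j : 'I_n) : exists k : 'I_K.+1,
    (j == i -> k = ord0) /\ (j != i -> cell k <= x 0 j <= cell k + w).
  have [->|ji] := eqVneq j i; first by exists ord0.
  have /(interval_cell K M0)[k kP] : `|x 0 j| <= M.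
    exact: le_trans (coord_le_l2norm _ _) (Xbounded Xx).
  by exists k.
have px : patch i b (finfun f) x.
  split => //; first by rewrite ffunE (fP i).1.
    by move=> j ji; rewrite ffunE; exact: (fP j).2.
  exists p; split => // j; apply: le_trans (imax j) _.
  rewrite /b; case: ltP => h; first by rewrite expr1 mulN1r ltr0_norm.
  by rewrite expr0 mul1r ger0_norm.
have pz := getPex (ex_intro _ _ px : exists x, patch i b (finfun f) x).
exists (i, b, finfun f) => // j; rewrite /far !mxE/= /side.
have [->|ji] := eqVneq j i; last by rewrite ffunE (fP j).2.
have := patch_width pz px; rewrite ffunE (fP i).1// eqxx ler_norml.
by move=> /andP[? ?]; apply/andP; split; lra.
Qed.

End shell.

(** Outside of the intersection, each of two nearby polytopes is a thin shell around
    the other. *)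
Lemma volume_dist_small (P : set 'rV[R]_n) (e : R) : is_polytope P -> 0 < e ->
  exists2 d : R, 0 < d & forall Q, is_polytope Q -> support_close d P Q ->
    (volume_dist P Q < e%:E)%E.
Proof.
move=> pP e0; have [B B0 PB] := polytope_bounded pP; pose M := B + 1.
have M0 : 0 < M by rewrite /M; lra.
pose C := 16 * n%:R ^+ 2 * (2 * M) ^+ n.-1 * (2 * M) + 1.
have C0 : 0 < C by rewrite /C ltr_wpDl// !mulr_ge0// ?exprn_ge0 ?mulr_ge0 ?(ltW M0).
pose K := Num.truncn (C / e); pose w := 2 * M / K.+1%:R.
have w0 : 0 < w by rewrite divr_gt0// mulr_gt0.
exists (Num.min 1 w); first by rewrite lt_min ltr01.
move=> Q pQ PQ.
have d0 : 0 <= Num.min 1 w by rewrite le_min ler01 ltW.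
have dw : Num.min 1 w <= w by rewrite ge_min lexx orbT.
have d1 : Num.min 1 w <= 1 by rewrite ge_min lexx.
have QM x : Q x -> l2norm x <= M.
  move=> /(support_close_near d0 pQ pP (support_closeC PQ))[y Py xy].
  rewrite -(subrK y x) /M addrC; apply: le_trans (l2norm_triangle _ _) _.
  by rewrite lerD ?PB// (le_trans xy).
have v1 : (vol (P `\` Q) <= (8 * n%:R ^+ 2 * w * (2 * M) ^+ n.-1)%:E)%E.
  apply: (vol_shell pQ M0 dw) => [x [Px _]|x [Px nQx]].
    by rewrite /M ler_wpDr// PB.
  by split => //; exact: support_close_near PQ Px.
have v2 : (vol (Q `\` P) <= (8 * n%:R ^+ 2 * w * (2 * M) ^+ n.-1)%:E)%E.
  apply: (vol_shell pP M0 dw) => [x [Qx _]|x [Qx nPx]]; first exact: QM.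
  by split => //; exact: support_close_near (support_closeC PQ) Qx.
apply: le_lt_trans (leeD v1 v2) _; rewrite -EFinD lte_fin.
have -> : 8 * n%:R ^+ 2 * w * (2 * M) ^+ n.-1 + 8 * n%:R ^+ 2 * w * (2 * M) ^+ n.-1 =
    (C - 1) / K.+1%:R by rewrite /C /w; field.
rewrite ltr_pdivrMr//.
have : C / e < K.+1%:R by exact: truncnS_gt.
by rewrite ltr_pdivrMr// mulrC => ?; lra.
Qed.

End volume.

(** * Support functions of shapes *)

Section normalized_support.
Context {R : realType} {n : nat}.
Implicit Types (a : 'rV[R]_n) (P Q : polytope R n) (d e : R).

(** The support function of the translate and dilate of [P] whose smallest enclosing
    ball is the unit ball about the origin. *)
Definition shape_support P a : R :=
  (support_function P a - dotp a (center P)) / radius P.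

Definition shape_close e P Q :=
  forall a, `|shape_support P a - shape_support Q a| <= e * l2norm a.

Lemma polytope_radius_gt0 P : 0 < radius P.
Proof. exact: radius_gt0 (psetP P) (@pset_not_point _ _ P). Qed.

Lemma shape_support_bound P a : `|shape_support P a| <= l2norm a.
Proof.
have r0 := polytope_radius_gt0 P.
rewrite /shape_support normrM normfV (gtr0_norm r0) ler_pdivrMr//.
have [x Px ->] := supportP a (psetP P); rewrite -dotpNr -dotpDr.
apply: le_trans (cauchy_schwarz_norm _ _) _; rewrite ler_wpM2l ?l2norm_ge0//.
exact: sub_enclosing_ball (psetP P) _ Px.
Qed.

Lemma shape_supportE P a :
  support_function P a = radius P * shape_support P a + dotp a (center P).
Proof.
by rewrite /shape_support mulrCA divff ?mulr1 ?subrK// gt_eqF// polytope_radius_gt0.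
Qed.

Lemma same_shape_support P Q : same_shape P Q -> shape_support P = shape_support Q.
Proof.
move=> /asboolP[l [t [l0 QE]]].
have ballQ : smallest_ball Q (l *: center P + t, l * radius P).
  have [/= r0 Pr rmin] := smallest_ballP (psetP P); split => /=.
  - by rewrite mulr_ge0// ltW.
  - rewrite QE => _ [x Px <-]; rewrite /closed_ball2/=.
    rewrite opprD addrACA subrr addr0 -scalerBr l2normZ gtr0_norm// ler_pM2l//.
    exact: Pr.
  - move=> c r r_ge0 Qr; rewrite mulrC -ler_pdivlMr//.
    apply: (rmin (l^-1 *: (c - t))) => [|x Px]; first by rewrite divr_ge0// ltW.
    have /Qr : (Q : set _) (l *: x + t) by rewrite QE; exists x.
    rewrite /closed_ball2/= ler_pdivlMr//.
    have -> : l *: x + t - c = l *: (x - l^-1 *: (c - t)).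
      rewrite scalerBr scalerA divff ?gt_eqF// scale1r.
      by rewrite opprB addrA addrAC.
    by rewrite l2normZ gtr0_norm// mulrC.
have [cQ rQ] := smallest_ball_unique (psetP Q) ballQ.
apply/funext => a; rewrite /shape_support -cQ -rQ.
have -> : support_function Q a = l * support_function P a + dotp a t.
  have [x Px xmax] := polytope_max a (psetP P).
  rewrite (support_eq Px xmax) -dotpZr -dotpDr; apply: support_eq.
    by rewrite QE; exists x.
  by rewrite QE => _ [y Py <-]; rewrite !dotp_lin lerD2r ler_pM2l// xmax.
rewrite dotpDr dotpZr invfM.
have := polytope_radius_gt0 P => r0.
by field; rewrite !gt_eqF.
Qed.

Lemma shape_class_eq P Q : shape_class P = shape_class Q -> same_shape P Q.
Proof. by move=> /eqP; rewrite /shape_class eqmodE. Qed.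

(** Close support functions give close normalizations: by [center_close] the centre
    depends on the polytope in a Hoelder continuous way with exponent 1/2. *)
Lemma shape_close_support_close P e : 0 < e -> exists2 d : R, 0 < d &
  forall Q, support_close d P Q -> shape_close e P Q.
Proof.
move=> e0; have r0 := polytope_radius_gt0 P.
pose d := Num.min (radius P / 2) (Num.min (e * radius P / 8) (e ^+ 2 * radius P / 192)).
have d0 : 0 < d.
  by rewrite !lt_min !divr_gt0// mulr_gt0// exprn_gt0.
exists d => // Q PQ a.
have [d1 [d2 d3]] : d <= radius P / 2 /\ d <= e * radius P / 8 /\
    d <= e ^+ 2 * radius P / 192.
  by split; [|split]; rewrite /d !ge_min lexx ?orbT.
have := center_close (ltW d0) (psetP P) (psetP Q) PQ.
have := radius_close (ltW d0) (psetP P) (psetP Q) PQ.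
have := PQ a; have := shape_support_bound P a.
have := cauchy_schwarz_norm a (center P - center Q).
rewrite dotpDr dotpNr.
have -> : shape_support P a - shape_support Q a =
  (support_function P a - support_function Q a
   - (dotp a (center P) - dotp a (center Q))
   - shape_support P a * (radius P - radius Q)) / radius Q.
  rewrite [in RHS]shape_supportE [support_function Q a]shape_supportE.
  by field; rewrite gt_eqF// polytope_radius_gt0.
have rQ0 := polytope_radius_gt0 Q.
move: (radius P) (radius Q) (dotp a (center P)) (dotp a (center Q))
  (shape_support P a) d1 d2 d3 r0 rQ0.
move: (support_function P a) (support_function Q a) => h h'.
move: (l2norm_ge0 a) (l2norm_ge0 (center P - center Q)).
move: (l2norm a) (l2norm (center P - center Q)) => na g na0 g0 r r' u u' s d1 d2 d3 r0 r'0.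
move=> cs sb hh rr gg.
rewrite normrM normfV (gtr0_norm r'0) ler_pdivrMr//.
have g_le : g <= e * r / 4.
  rewrite -(@ler_pXn2r _ 2) ?nnegrE ?divr_ge0 ?mulr_ge0 ?(ltW e0) ?(ltW r0)//.
  apply: le_trans gg _.
  have dr : d * (r + d) <= (e ^+ 2 * r / 192) * (3 / 2 * r).
    by apply: ler_pM => //; [exact: ltW|lra|lra].
  have -> : (e * r / 4) ^+ 2 = 8 * ((e ^+ 2 * r / 192) * (3 / 2 * r)) by field.
  by rewrite -mulrA ler_pM2l.
have r'_ge : r / 2 <= r' by move: rr; rewrite ler_norml => /andP[? ?]; lra.
apply: (@le_trans _ _ ((e * r / 2) * na)); last first.
  by rewrite [leRHS]mulrAC ler_wpM2r// -mulrA ler_pM2l.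
apply: (@le_trans _ _ (d * na + na * g + na * d)).
  apply: le_trans (ler_normB _ _) _; rewrite lerD//.
    by apply: le_trans (ler_normB _ _) _; rewrite lerD.
  by rewrite normrM ler_pM.
have -> : d * na + na * g + na * d = (2 * d + g) * na by ring.
by rewrite ler_wpM2r//; lra.
Qed.

Lemma support_close_coordinates P e : 0 < e -> exists2 d : R, 0 < d &
  forall Q, shape_close d P Q -> l2norm (center P - center Q) <= d ->
    `|radius P - radius Q| <= d -> support_close e P Q.
Proof.
move=> e0; have r0 := polytope_radius_gt0 P.
pose d := Num.min 1 (e / (radius P + 3)).
have d0 : 0 < d by rewrite lt_min ltr01 divr_gt0// addr_gt0.
exists d => // Q PQ gd rd a.
have d1 : d <= 1 by rewrite /d ge_min lexx.
have de : d * (radius P + 3) <= e.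
  by rewrite -ler_pdivlMr ?addr_gt0// /d ge_min lexx orbT.
have := cauchy_schwarz_norm a (center P - center Q).
have := PQ a; have := shape_support_bound P a; have rQ0 := polytope_radius_gt0 Q.
rewrite dotpDr dotpNr !shape_supportE.
have := l2norm_ge0 a; have := l2norm_ge0 (center P - center Q).
move: (l2norm (center P - center Q)) gd => g gd.
move: (radius P) (radius Q) r0 rQ0 rd de => r r' r0 r'0 rd de.
move: (l2norm a) (shape_support P a) (shape_support Q a) => na s s'.
move: (dotp a (center P)) (dotp a (center Q)) => u u' g0 na0 sb ss cs.
have -> : r * s + u - (r' * s' + u') = r' * (s - s') + (r - r') * s + (u - u') by ring.
apply: (@le_trans _ _ (r' * (d * na) + d * na + na * d)).
  apply: le_trans (ler_normD _ _) _; rewrite lerD//; last first.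
    by apply: le_trans cs _; rewrite ler_wpM2l.
  apply: le_trans (ler_normD _ _) _; rewrite lerD//.
    by rewrite normrM (gtr0_norm r'0) ler_pM2l.
  by rewrite normrM ler_pM.
have -> : r' * (d * na) + d * na + na * d = (d * (r' + 2)) * na by ring.
rewrite ler_wpM2r//; apply: le_trans de; rewrite ler_pM2l//.
by move: rd; rewrite ler_norml => /andP[? ?]; lra.
Qed.

End normalized_support.

(** * Neighbourhoods in the CW topology *)

Section CW_neighbourhoods.
Context {R : realType} {n : nat}.
Implicit Types (a : 'rV[R]_n) (P Q : polytope R n) (d e : R).
Implicit Types (N : set (set 'rV[R]_n)).

Definition fan_polytope N (P : fan_cone N) : polytope R n := val (P : fan_polytopes N).

Lemma fan_support_continuous N a :
  continuous (fun P : fan_cone N => support_function (fan_polytope P) a).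
Proof.
move=> P; apply: (@continuous_comp _ _ _ (@fan_support R n N : fan_cone N -> _)
  (fun f : {ptws 'rV[R]_n -> R} => f a)).
  exact: initial_continuous.
exact: (@proj_continuous _ (fun=> R^o) a).
Qed.

Lemma near_fan_support N (P : fan_cone N) (L : seq 'rV[R]_n) d : 0 < d ->
  \forall Q \near P, forall a, a \in L ->
    `|support_function (fan_polytope P) a - support_function (fan_polytope Q) a| <= d.
Proof.
have FP := nbhs_filter P.
move=> d0; elim: L => [|b L IH]; first by apply: (filterE FP) => Q a; rewrite in_nil.
have /cvgrPdist_le/(_ d d0) near_b := @fan_support_continuous N b P.
apply: (filterS2 FP _ near_b IH) => Q ? QL a; rewrite inE => /predU1P[->//|].
exact: QL.
Qed.

Lemma near_support_close N (P : fan_cone N) e : 0 < e ->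
  \forall Q \near P, support_close e (fan_polytope P) (fan_polytope Q).
Proof.
move=> e0; have [L [d [d0 LP]]] := support_close_net (psetP (fan_polytope P)) e0.
apply: (@filterS _ _ (nbhs_filter P) _ _ _ (near_fan_support P L d0)) => Q.
exact: LP (psetP _).
Qed.

Definition shape_ball P e : set (polytope_shape R n) :=
  [set s | exists Q, shape_class Q = s /\ exists2 d, d < e & shape_close d P Q].

(** On a cell, support functions converge uniformly by [support_close_net], and then so
    do their normalizations by [shape_close_support_close]. *)
Lemma shape_ball_open P e : open (shape_ball P e).
Proof.
suff : CW_open (shape_ball P e) by [].
rewrite CW_openE => N _ _; rewrite openE => Q0 [Q [QQ0 [d de PQ]]].
have {}PQ : shape_close d P (fan_polytope Q0).
  by move=> a; rewrite -(same_shape_support (shape_class_eq QQ0)).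
have ed0 : 0 < (e - d) / 2 by rewrite divr_gt0// subr_gt0.
have [d' d'0 close] := shape_close_support_close (fan_polytope Q0) ed0.
apply: (@filterS _ _ (nbhs_filter Q0) _ _ _ (near_support_close Q0 d'0)) => Q1 /close Q01.
exists (fan_polytope Q1); split => //; exists (d + (e - d) / 2); first by lra.
by move=> a; have := PQ a; have := Q01 a; rewrite !ler_norml mulrDl;
  move=> /andP[? ?] /andP[? ?]; apply/andP; split; lra.
Qed.

(** The three CW coordinates control the support function, because it is obtained from
    the normalized one by a dilation by the radius and a translation to the centre. *)
Lemma CW_nbhs_support_close P e : 0 < e -> exists U : set (@CW_polytope R n),
  [/\ open U, U P & forall Q, U Q -> support_close e P Q].
Proof.
move=> e0; have [d d0 close] := support_close_coordinates P e0.
have n0 : 0 < n%:R + 1 :> R by rewrite ltr_wpDl.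
pose W := [set z : polytope_shape R n * 'rV[R]_n * R |
  [/\ shape_ball P d z.1.1, ball (center P) (d / (n%:R + 1)) z.1.2 &
      ball (radius P) d z.2]].
exists (@CW_coordinates R n @^-1` W); split.
- exists W => //.
  have -> : W = (fst \o fst) @^-1` shape_ball P d `&`
      ((snd \o fst) @^-1` ball (center P) (d / (n%:R + 1)) `&`
       snd @^-1` ball (radius P) d).
    by apply/seteqP; split => z /=; [case|case=> ? []].
  apply: openI; last apply: openI.
  + apply: open_comp; last exact: shape_ball_open.
    by move=> z _; apply: continuous_comp; exact: cvg_fst.
  + apply: open_comp; last exact: (@ball_open _ _ (center P) (d / (n%:R + 1))).
    by move=> z _; apply: continuous_comp; [exact: cvg_fst|exact: cvg_snd].
  + apply: open_comp; last exact: ball_open.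
    by move=> z _; exact: cvg_snd.
- split => /=; [|exact: ballxx (divr_gt0 d0 n0)|exact: ballxx].
  exists P; split => //; exists 0 => // a.
  by rewrite subrr normr0 mul0r.
- move=> Q [/= [Q' [Q'Q [d' d'd PQ]]] cPQ rPQ]; apply: close.
  + move=> a; rewrite -(same_shape_support (shape_class_eq Q'Q)).
    by apply: le_trans (PQ a) _; rewrite ler_wpM2r ?l2norm_ge0// ltW.
  + move: cPQ; rewrite -ball_normE /ball_/= ltr_pdivlMr// => /ltW.
    apply: le_trans; apply: le_trans (l2norm_le_mx_norm _) _.
    by rewrite mulrC ler_wpM2l// lerDl.
  + by move: rPQ; rewrite -ball_normE /ball_/= => /ltW.
Qed.

Definition support_controlled (dist : polytope R n -> polytope R n -> \bar R) :=
  forall P (e : R), 0 < e -> exists2 d : R, 0 < d &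
    forall Q, support_close d P Q -> (dist P Q < e%:E)%E.

(** The union of the CW open sets that meet [S] inside [A] is the whole of [A] on [S]. *)
Lemma metric_topology_sub dist S : support_controlled dist ->
  metric_topology dist S `<=` CW_topology S.
Proof.
move=> small A [AS Adist].
pose U := \bigcup_(V in [set V : set (@CW_polytope R n) | open V /\ V `&` S `<=` A]) V.
exists U; first by apply: bigcup_open => V [].
apply/seteqP; split => [P AP|P [[V [_ VA] VP] SP]]; last exact: VA.
split; last exact: AS.
have [e e0 Ae] := Adist _ AP; have [d d0 de] := small P e e0.
have [V [Vo VP Vd]] := CW_nbhs_support_close P d0.
by exists V => //; split => // Q [/Vd/de PQ SQ]; exact: Ae.
Qed.

End CW_neighbourhoods.

(** * Delzant polytopes from smooth corners *)

Section smooth_polytopes.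
Context {R : realType} {n : nat}.
Implicit Types (a x y z : 'rV[R]_n) (P F : set 'rV[R]_n) (B C : 'M[int]_n).

Lemma conv_pairP x y z :
  conv [:: x; y] z <-> exists2 t : R, 0 <= t <= 1 & z = x + t *: (y - x).
Proof.
split=> [[c [c0 c1 ->]]|[t t01 ->]]; last first.
  by apply: conv_convex => //; apply: mem_conv; rewrite !inE eqxx ?orbT.
move: c1; rewrite !big_ord_recl !big_ord0/= !addr0 => c1.
exists (c (lift ord0 ord0)).
  by rewrite c0 -c1 lerDr c0.
have -> : c ord0 = 1 - c (lift ord0 ord0) by rewrite -c1 addrK.
by apply/rowP => k; rewrite !mxE; ring.
Qed.

Lemma conv_pairC x y : conv [:: x; y] = conv [:: y; x].
Proof.
have sub (u v : 'rV[R]_n) : conv [:: u; v] `<=` conv [:: v; u].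
  move=> z /conv_pairP[t /andP[t0 t1] ->]; apply/conv_pairP; exists (1 - t).
    by rewrite subr_ge0 t1/= gerBl.
  by apply/rowP => k; rewrite !mxE; ring.
by apply/seteqP; split; exact: sub.
Qed.

Lemma is_edgeC P F x y : is_edge P F x y -> is_edge P F y x.
Proof. by move=> [fF xy FE]; split; rewrite 1?eq_sym// conv_pairC. Qed.

Lemma vertex_generator (s : seq 'rV[R]_n) x : is_vertex (conv s) x -> x \in s.
Proof.
move=> [_ [a xE]]; have xF : face (conv s) a x by rewrite -xE.
have [y|v [vs + _]] := face_generator (b := 0) xF; first by rewrite !dotp0l.
by rewrite -xE => <-.
Qed.

Lemma edge_generator (s : seq 'rV[R]_n) F x y : is_edge (conv s) F x y -> x \in s.
Proof.
move=> [[_ [a FE]] xy Fxy].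
have xF : face (conv s) a x.
  by rewrite -FE Fxy; apply: mem_conv; rewrite mem_head.
have yx0 : 0 < dotp (y - x) (y - x).
  by rewrite -sqr_l2norm exprn_gt0// l2norm_gt0// subr_eq0 eq_sym.
have [z|v [vs]] := face_generator (b := x - y) xF.
  rewrite -FE Fxy => /conv_pairP[t /andP[t0 _] ->].
  rewrite dotpDr dotpZr gerDl -opprB dotpNl mulrN oppr_le0.
  by rewrite mulr_ge0// ltW.
rewrite -FE Fxy => /conv_pairP[t /andP[t0 _] vE] /eqP.
rewrite {1}vE dotpDr dotpZr -[_ + _ == _]subr_eq0 addrAC subrr add0r mulf_eq0.
rewrite -[x - y]opprB dotpNl oppr_eq0 (gt_eqF yx0) orbF => /eqP t00.
by rewrite -[x]addr0 -(scale0r (y - x)) -t00 -vE.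
Qed.

Lemma dotp_col (M : 'M[R]_n) i z : dotp (col i M)^T z = (z *m M) 0 i.
Proof.
by rewrite dotpC dotpE trmxK !mxE; apply: eq_bigr => j _; rewrite [in LHS]mxE.
Qed.

Section corner.
Variables (P : set 'rV[R]_n) (x : 'rV[R]_n) (B C : 'M[int]_n).
Hypotheses (pP : is_polytope P) (Px : P x) (BC : B *m C = 1%:M).

Let ray i : 'rV[R]_n := row i (map_mx intr B).
Let dual i : 'rV[R]_n := (col i (map_mx intr C))^T.

Hypothesis cone : forall y i, P y -> 0 <= dotp (dual i) (y - x).
Hypothesis rayP : forall i, exists2 t : R, 0 < t & P (x + t *: ray i).

Let dualE i z : dotp (dual i) z = (z *m map_mx intr C) 0 i.
Proof. exact: dotp_col. Qed.

Let expand z : z = \sum_i dotp (dual i) z *: ray i.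
Proof.
have CB : map_mx intr C *m map_mx intr B = 1%:M :> 'M[R]_n.
  by rewrite -map_mxM (mulmx1C BC) map_mx1.
rewrite -[LHS]mulmx1 -CB mulmxA mulmx_sum_row.
by apply: eq_bigr => i _; rewrite dualE.
Qed.

Let dual_ray i j : dotp (dual i) (ray j) = (j == i)%:R.
Proof. by rewrite dualE -row_mul -map_mxM BC map_mx1 !mxE. Qed.

Let ray_neq0 i : ray i != 0.
Proof.
apply/eqP => r0; have := dual_ray i i; rewrite r0 dotp0r eqxx => /eqP.
by rewrite eq_sym oner_eq0.
Qed.

(** A functional that is zero on the i-th ray and negative on the other rays. *)
Let edge_functional i : 'rV[R]_n := - \sum_(j | j != i) dual j.

Let dotp_edge_functional i z :
  dotp (edge_functional i) z = - \sum_(j | j != i) dotp (dual j) z.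
Proof.
rewrite dotpNl; congr (- _).
by elim/big_rec2 : _ => [|j u v _ <-]; rewrite ?dotp0l ?dotpDl.
Qed.

Let edge i := face P (edge_functional i).

Let edgeP i y : edge i y <-> P y /\ exists s : R, y = x + s *: ray i.
Proof.
have le_x z : P z -> dotp (edge_functional i) (z - x) <= 0.
  by move=> Pz; rewrite dotp_edge_functional oppr_le0 sumr_ge0// => j _; exact: cone.
split=> [[Py ymax]|[Py [s yE]]].
  split=> //; exists (dotp (dual i) (y - x)).
  have := ymax _ Px; rewrite -subr_ge0 -dotpNr -dotpDr => ge0.
  have /eqP : dotp (edge_functional i) (y - x) = 0.
    by apply/le_anti; rewrite ge0 le_x.
  rewrite dotp_edge_functional oppr_eq0 psumr_eq0 => [/allP y0|j _]; last exact: cone.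
  rewrite -[LHS](subrK x) addrC {1}[y - x]expand (bigD1 i)//= big1 ?addr0// => j ji.
  by have := y0 j; rewrite mem_index_enum ji => /(_ isT)/= /eqP ->; rewrite scale0r.
split=> // z Pz; rewrite -subr_le0 -dotpNr -dotpDr.
suff -> : dotp (edge_functional i) (z - y) = dotp (edge_functional i) (z - x).
  exact: le_x.
have f0 : dotp (edge_functional i) (ray i) = 0.
  rewrite dotp_edge_functional big1 ?oppr0// => j ji.
  by rewrite dual_ray eq_sym (negbTE ji).
by rewrite yE [LHS]dotpDr dotpNr dotpDr dotpZr f0 mulr0 addr0 dotpDr dotpNr.
Qed.

Let polytope_segment y z (t : R) : 0 <= t <= 1 -> P y -> P z -> P (y + t *: (z - y)).
Proof. by case: pP => s [_ ->] => t01; exact: conv_convex. Qed.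

(** The face exposed by [edge_functional i] is compact and lies on the i-th ray, so it is
    the segment from [x] to its farthest point. *)
Let edge_exists i : exists y (s : R),
  [/\ 0 < s, y = x + s *: ray i & is_edge P (edge i) x y].
Proof.
have edge_x : edge i x by apply/edgeP; split => //; exists 0; rewrite scale0r addr0.
have edge_compact : compact (edge i).
  have -> : edge i = P `&` (dotp (edge_functional i) @^-1`
      [set r | dotp (edge_functional i) x <= r]).
    apply/seteqP; split => [y [Py ymax]|y [Py xy]]; first by split => //; exact: ymax.
    split => // z /edge_x.2 zx; exact: le_trans zx xy.
  apply: compact_closedI (polytope_compact pP) _.
  by apply: closed_comp (@closed_ge _ _) => z _; exact: dotp_continuous.
have [y] := EVT_max_rV (ex_intro _ _ edge_x) edge_compact
  (continuous_subspaceT (@dotp_continuous _ _ (dual i))).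
rewrite inE => edge_y ymax; have [Py [s yE]] := (edgeP i y).1 edge_y.
have dual_x r : dotp (dual i) (x + r *: ray i) = dotp (dual i) x + r.
  by rewrite dotpDr dotpZr dual_ray eqxx mulr1.
have s_max z r : P z -> z = x + r *: ray i -> r <= s.
  move=> Pz zE; have /mem_set/ymax : edge i z by apply/edgeP; split => //; exists r.
  by rewrite zE yE !dual_x lerD2l.
have s0 : 0 < s by have [t t0 Pt] := rayP i; apply: lt_le_trans t0 (s_max _ _ Pt erefl).
exists y, s; split => //; split.
- by split; [exists x|exists (edge_functional i)].
- rewrite yE -subr_eq0 opprD addrA subrr add0r oppr_eq0 scaler_eq0 negb_or.
  by rewrite gt_eqF//= ray_neq0.
- apply/seteqP; split => [z /edgeP[Pz [r zE]]|z /conv_pairP[t t01 zE]].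
    apply/conv_pairP; exists (r / s).
      rewrite ler_pdivrMr// mul1r (s_max z)// andbT divr_ge0 ?(ltW s0)//.
      have := cone i Pz; rewrite dotpDr dotpNr zE dual_x addrAC subrr add0r; exact.
    by rewrite zE yE [x + _ - x]addrAC subrr add0r scalerA divfK// gt_eqF.
  apply/edgeP; split; first by rewrite zE; exact: polytope_segment.
  by exists (t * s); rewrite zE yE [x + _ - x]addrAC subrr add0r scalerA.
Qed.

(** A functional that exposes an edge at [x] is nonpositive on the rays.  It vanishes
    on a ray that contributes to the direction of the edge, so this ray carries the
    edge. *)
Let edge_at_corner F y : is_edge P F x y -> exists i (s : R),
  [/\ 0 < s, y - x = s *: ray i & F = edge i].
Proof.
move=> [[_ [a Fa]] xy Fxy].
have Fx : face P a x by rewrite -Fa Fxy; apply: mem_conv; rewrite mem_head.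
have Fy : face P a y by rewrite -Fa Fxy; apply: mem_conv; rewrite !inE eqxx orbT.
have ray_le i : dotp a (ray i) <= 0.
  have [t t0 /(Fx.2)] := rayP i.
  by rewrite dotpDr gerDl dotpZr pmulr_rle0.
have ayx : dotp a (y - x) = 0.
  by apply/eqP; rewrite dotpDr dotpNr subr_eq0 eq_le (Fx.2 _ Fy.1) (Fy.2 _ Px).
have [i yi] : exists i, 0 < dotp (dual i) (y - x).
  apply: contrapT => /forallNP npos; move/eqP : xy; apply; apply/esym/eqP.
  rewrite -subr_eq0 [y - x]expand big1// => i _.
  have -> : dotp (dual i) (y - x) = 0; last by rewrite scale0r.
  by apply/le_anti; rewrite cone ?andbT; [rewrite leNgt; exact/negP/npos|exact: Fy.1].
have ai : dotp a (ray i) = 0.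
  move: ayx => /eqP; rewrite [y - x]expand dotp_sumr -oppr_eq0 -sumrN psumr_eq0.
    move=> /allP/(_ i); rewrite mem_index_enum dotpZr => /(_ isT)/=.
    by rewrite oppr_eq0 mulf_eq0 gt_eqF//= => /eqP.
  move=> j _; rewrite dotpZr -mulrN mulr_ge0 ?oppr_ge0//.
  exact: cone Fy.1.
have along z (s : R) : z = x + s *: ray i -> P z -> F z.
  move=> zE Pz; rewrite Fa; split => // w /Fx.2/le_trans; apply.
  by rewrite zE dotpDr dotpZr ai mulr0 addr0.
have [t t0 Pt] := rayP i.
have : conv [:: x; y] (x + t *: ray i) by rewrite -Fxy; exact: (along _ t).
move=> /conv_pairP[r /andP[r0 _]].
move/addrI => tr.
have {}r0 : 0 < r.
  rewrite lt_neqAle r0 andbT; apply/negP => /eqP r00.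
  move: tr; rewrite -r00 scale0r => /eqP.
  by rewrite scaler_eq0 gt_eqF//= (negbTE (ray_neq0 i)).
have yE : y - x = (t / r) *: ray i.
  by rewrite mulrC -scalerA tr scalerA mulVf ?gt_eqF// scale1r.
exists i, (t / r); split => //; first by rewrite divr_gt0.
apply/seteqP; split => [z Fz|z /edgeP[Pz [s zE]]]; last exact: (along z s).
apply/edgeP; split; first by move: Fz; rewrite Fa => -[].
move: Fz; rewrite Fxy => /conv_pairP[u _ ->]; exists (u * (t / r)).
by rewrite yE scalerA.
Qed.

(** Since [P] lies in a pointed cone with apex [x], this point is not inside a segment of
    [P]. *)
Let corner_endpoint F y z : is_edge P F y z -> F x -> exists y', is_edge P F x y'.
Proof.
move=> eF; have [[_ [a Fa]] yz Fyz] := eF.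
have Py : P y.
  suff : face P a y by case.
  by rewrite -Fa Fyz; apply: mem_conv; rewrite mem_head.
have Pz : P z.
  suff : face P a z by case.
  by rewrite -Fa Fyz; apply: mem_conv; rewrite !inE eqxx orbT.
move=> Fx; have : conv [:: y; z] x by rewrite -Fyz.
move=> /conv_pairP[t /andP[t0 t1] xE].
have [t00|tpos] := eqVneq t 0.
  exists z; suff -> : x = y by [].
  by rewrite xE t00 scale0r addr0.
have [t11|tneq1] := eqVneq t 1.
  exists y; apply: is_edgeC; move: eF.
  suff -> : x = z by [].
  by rewrite xE t11 scale1r addrC subrK.
have {}t0 : 0 < t by rewrite lt_neqAle eq_sym tpos.
have {}t1 : t < 1 by rewrite lt_neqAle tneq1.
have coord0 i : dotp (dual i) (z - y) = 0.
  have := cone i Pz; have := cone i Py; rewrite xE !dotp_lin.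
  move: (dotp _ y) (dotp _ z) => u v h1 h2; have {}h1 : 0 <= t * (u - v) by lra.
  have {}h2 : 0 <= (1 - t) * (v - u) by lra.
  move: h1 h2; rewrite !pmulr_rge0 ?subr_gt0// => ? ?; lra.
move/negP : yz; case; rewrite eq_sym -subr_eq0 [z - y]expand big1// => i _.
by rewrite coord0 scale0r.
Qed.

Lemma corner_edges_card : ([set F | (exists y z, is_edge P F y z) /\ F x] #= `I_n)%card.
Proof.
have -> : [set F | (exists y z, is_edge P F y z) /\ F x] = edge @` [set: 'I_n].
  apply/seteqP; split => [F [[y [z eF]] Fx]|_ [i _ <-]].
    have [y' /edge_at_corner[i [s [_ _ ->]]]] := corner_endpoint eF Fx.
    by exists i.
  have [y [s [s0 yE ei]]] := edge_exists i; split; first by exists x, y.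
  by apply/edgeP; split => //; exists 0; rewrite scale0r addr0.
rewrite (card_eqr card_II); apply: inj_card_eq => i j _ _ eij.
have [y [s [s0 yE [_ _ Fxy]]]] := edge_exists i.
have : edge i y by rewrite Fxy; apply: mem_conv; rewrite !inE eqxx orbT.
rewrite eij => /edgeP[_ [r]]; rewrite yE => /addrI/(congr1 (dotp (dual i))).
rewrite !dotpZr !dual_ray eqxx mulr1; have [//|] := eqVneq j i.
by rewrite mulr0 => _ /eqP; rewrite gt_eqF.
Qed.

Lemma corner_edge_rational F y : is_edge P F x y -> rational_direction (y - x).
Proof.
move=> /edge_at_corner[i [s [_ -> _]]]; exists s, (map_mx intr (row i B)).
congr (_ *: _); apply/rowP => j; rewrite !mxE.
by rewrite ratr_int.
Qed.

Let basis_row_primitive i : primitive (row i B).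
Proof.
rewrite /primitive; set g := \big[gcdn/0]_(_ < n) _.
have g_dvd j : (g %| `|B i j|)%N.
  have <- : row i B 0 j = B i j by rewrite mxE.
  exact: (biggcdn_inf j).
have : (g%:Z %| (B *m C) i i)%Z.
  by rewrite mxE; apply: rpred_sum => j _; apply: dvdz_mulr; exact: g_dvd.
by rewrite BC mxE eqxx dvdz1 /= => /eqP.
Qed.

Lemma corner_primitive :
  [set u | primitive_edge_vector P x u] = [set row i B | i in setT].
Proof.
apply/seteqP; split => [u [pu [F [y [t [eF t0 yxE]]]]]|_ [i _ <-]].
  have [i [s [s0 yxE' _]]] := edge_at_corner eF.
  have uE : map_mx intr u = (s / t) *: ray i.
    by rewrite mulrC -scalerA -yxE' yxE scalerA mulVf ?gt_eqF// scale1r.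
  (* The factor between u and the i-th row of B is an integer. *)
  pose m := (u *m C) 0 i.
  have mE : m%:~R = s / t.
    have := congr1 (dotp (dual i)) uE; rewrite dotpZr dual_ray eqxx mulr1 => <-.
    by rewrite dualE -map_mxM mxE.
  have umB : u = m *: row i B.
    apply/rowP => j; apply: (@intr_inj R).
    have := congr1 (fun v : 'rV[R]_n => v 0 j) uE.
    by rewrite !mxE rmorphM /= mE.
  have m0 : 0 < m by rewrite -(ltr0z R) mE divr_gt0.
  have m_dvd : (`|m|%N %| 1)%N.
    rewrite -pu; apply/dvdn_biggcdP => j _.
    by rewrite umB mxE abszM dvdn_mulr.
  exists i => //; rewrite umB.
  have -> : m = 1 by move: m0 m_dvd; case: (m) => // k _; rewrite dvdn1 => /eqP /= ->.
  by rewrite scale1r.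
split; first exact: basis_row_primitive.
have [y [s [s0 yE ei]]] := edge_exists i.
exists (edge i), y, s; split => //.
by rewrite yE addrAC subrr add0r map_row.
Qed.

End corner.

Lemma inverse_lattice_basis B C : B *m C = 1%:M -> lattice_basis B.
Proof.
move=> BC z; exists (z *m C); split.
  by rewrite -mulmxA (mulmx1C BC) mulmx1.
by move=> c ->; rewrite -mulmxA BC mulmx1.
Qed.

(** The Delzant condition expressed by generators, without any enumeration of faces: [C]
    computes coordinates with respect to the rows of [B]. *)
Definition smooth_vertices (V : seq 'rV[R]_n) := forall x, x \in V ->
  exists B C : 'M[int]_n, [/\ B *m C = 1%:M,
    forall v i, v \in V -> 0 <= ((v - x) *m map_mx intr C) 0 i &
    forall i, exists2 t : R, 0 < t & x + t *: row i (map_mx intr B) \in V].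

Lemma smooth_corner V x : smooth_vertices V -> x \in V -> exists B C : 'M[int]_n,
  [/\ B *m C = 1%:M,
      forall y i, conv V y -> 0 <= dotp (col i (map_mx intr C))^T (y - x) &
      forall i, exists2 t : R, 0 < t & conv V (x + t *: row i (map_mx intr B))].
Proof.
move=> sV xV; have [B [C [BC cone ray]]] := sV _ xV; exists B, C; split => //.
- move=> y i Vy; rewrite dotpDr dotpNr subr_ge0 -lerN2 -!dotpNl.
  apply: conv_dotp_le Vy => v vV; rewrite !dotpNl lerN2 -subr_ge0 -dotpNr -dotpDr.
  by rewrite dotp_col; exact: cone.
- by move=> i; have [t t0 tV] := ray i; exists t => //; exact: mem_conv.
Qed.

(** At each generator the polytope lies between a unimodular cone and the segments of it
    on the rays of this cone, and this determines the edges there.  Vertices and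
    endpoints of edges are generators. *)
Lemma smooth_conv_delzant V : V != [::] -> smooth_vertices V -> is_delzant (conv V).
Proof.
move=> V0 sV; have pV : is_polytope (conv V) by exists V.
split.
- have [x xV] : exists x, x \in V by case: (V) V0 => // x s _; exists x; rewrite mem_head.
  have [B [C [BC _ ray]]] := sV _ xV.
  have /choice[t tV] i : exists t : R, 0 < t /\ x + t *: row i (map_mx intr B) \in V.
    by have [t t0 tV] := ray i; exists t.
  exists x, (\matrix_i (t i *: row i (map_mx intr B))); split.
  + exact: mem_conv.
  + by move=> i; rewrite rowK; apply: mem_conv; have [] := tV i.
  + have -> : \matrix_i (t i *: row i (map_mx intr B)) =
        diag_mx (\row_i t i) *m map_mx intr B :> 'M[R]_n.
      by apply/matrixP => i j; rewrite mul_diag_mx !mxE.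
    rewrite unitmx_mul; apply/andP; split.
      rewrite unitmxE det_diag unitfE; apply/prodf_neq0 => i _.
      by rewrite mxE gt_eqF//; have [] := tV i.
    have /mulmx1_unit[] // : map_mx intr B *m map_mx intr C = 1%:M :> 'M[R]_n.
    by rewrite -map_mxM BC map_mx1.
- move=> x /vertex_generator xV; have [B [C [BC cone ray]]] := smooth_corner sV xV.
  exact: corner_edges_card pV (mem_conv xV) BC cone ray.
- move=> F x y eF; have xV := edge_generator eF.
  have [B [C [BC cone ray]]] := smooth_corner sV xV.
  by have := corner_edge_rational (mem_conv xV) BC cone ray eF.
- move=> x /vertex_generator xV; have [B [C [BC cone ray]]] := smooth_corner sV xV.
  exists B; first exact: inverse_lattice_basis BC.
  exact: corner_primitive pV (mem_conv xV) BC cone ray.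
Qed.

End smooth_polytopes.

(** * Products and cubes *)

Section products.
Context {R : realType} {n1 n2 : nat}.

Definition vertex_product (s1 : seq 'rV[R]_n1) (s2 : seq 'rV[R]_n2) : seq 'rV[R]_(n1 + n2) :=
  [seq row_mx x y | x <- s1, y <- s2].

Lemma smooth_vertex_product s1 s2 : smooth_vertices s1 -> smooth_vertices s2 ->
  smooth_vertices (vertex_product s1 s2).
Proof.
move=> sm1 sm2 _ /allpairsP[[x y] [/= xs ys ->]].
have [B1 [C1 [BC1 cone1 ray1]]] := sm1 _ xs.
have [B2 [C2 [BC2 cone2 ray2]]] := sm2 _ ys.
exists (block_mx B1 0 0 B2), (block_mx C1 0 0 C2); split.
- rewrite mulmx_block !mulmx0 !mul0mx !addr0 !add0r BC1 BC2.
  by rewrite -scalar_mx_block.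
- move=> _ i /allpairsP[[x' y'] [/= x's y's ->]].
  rewrite opp_row_mx add_row_mx map_block_mx !map_mx0 mul_row_block !mulmx0 addr0 add0r.
  rewrite mxE; case: (fintype.splitP i) => j _; [exact: cone1|exact: cone2].
- move=> i; rewrite map_block_mx !map_mx0 /block_mx -(fintype.splitK i).
  case: (fintype.split i) => j /=.
    have [t t0 tx] := ray1 j; exists t => //.
    rewrite rowKu row_row_mx row0 scale_row_mx scaler0 add_row_mx addr0.
    by apply/allpairsP; exists (x + t *: row j (map_mx intr B1), y).
  have [t t0 ty] := ray2 j; exists t => //.
  rewrite rowKd row_row_mx row0 scale_row_mx scaler0 add_row_mx addr0.
  by apply/allpairsP; exists (x, y + t *: row j (map_mx intr B2)).
Qed.

Lemma vertex_product_neq0 s1 s2 : s1 != [::] -> s2 != [::] ->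
  vertex_product s1 s2 != [::].
Proof. by case: s1 => // x s1; case: s2. Qed.

End products.

Section cube.
Context {R : realType}.

Definition segment_vertices : seq 'rV[R]_1 := [:: const_mx 0; const_mx 1].

Lemma segment_smooth : smooth_vertices segment_vertices.
Proof.
move=> x; rewrite !inE => /orP[] /eqP ->.
  exists 1%:M, 1%:M; split; first by rewrite mulmx1.
    move=> v i; rewrite map_mx1 mulmx1 ord1 !mxE !inE => /orP[] /eqP ->; rewrite mxE; lra.
  move=> i; exists 1 => //; rewrite !inE; apply/orP; right; apply/eqP/rowP => j.
  by rewrite !ord1 !mxE eqxx mulr1n add0r mulr1.
exists (-1)%:M, (-1)%:M; split; first by rewrite -scalar_mxM.
  move=> v i; rewrite map_scalar_mx mul_mx_scalar ord1 !mxE !inE.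
  by move=> /orP[] /eqP ->; rewrite mxE rmorphN1; lra.
move=> i; exists 1 => //; rewrite !inE; apply/orP; left; apply/eqP/rowP => j.
by rewrite !ord1 !mxE eqxx mulr1n rmorphN1; ring.
Qed.

Fixpoint cube_vertices m : seq 'rV[R]_m :=
  if m is m'.+1 then vertex_product segment_vertices (cube_vertices m') else [:: 0].

Lemma cube_smooth m : smooth_vertices (cube_vertices m).
Proof.
elim: m => [|m IH]; last exact: (smooth_vertex_product segment_smooth IH).
move=> x _; exists 1%:M, 1%:M; split; [by rewrite mulmx1|by move=> v []|by case].
Qed.

Lemma cube_vertices_neq0 m : cube_vertices m != [::].
Proof. by elim: m => // m IH; exact: vertex_product_neq0. Qed.

End cube.

(** * Squares with a chain of edges inserted at a corner *)

Section polygon.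
Context {R : realType}.
Implicit Types (x y t eps : R) (K i j : nat) (v w : 'rV[R]_2).

Definition point x y : 'rV[R]_2 := \row_i if i == 0 :> nat then x else y.

Lemma point_x x y : point x y 0 ord0 = x. Proof. by rewrite mxE. Qed.
Lemma point_y x y : point x y 0 ord_max = y. Proof. by rewrite mxE. Qed.

Lemma ord2P (P : 'I_2 -> Prop) : P ord0 -> P ord_max -> forall i : 'I_2, P i.
Proof.
move=> P0 P1 [[|[|//]] lti].
  by have -> : Ordinal lti = ord0 by exact/val_inj.
by have -> : Ordinal lti = ord_max by exact/val_inj.
Qed.

Lemma big_ord2 (F : 'I_2 -> R) : \sum_i F i = F ord0 + F ord_max.
Proof.
by rewrite big_ord_recl big_ord1; congr (_ + F _); exact/val_inj.
Qed.

Lemma row2P v w : v 0 ord0 = w 0 ord0 -> v 0 ord_max = w 0 ord_max -> v = w.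
Proof. by move=> h0 h1; apply/rowP; apply: ord2P. Qed.

Lemma point_mem (V : seq 'rV[R]_2) x y x' y' :
  x' = x -> y' = y -> point x' y' \in V -> point x y \in V.
Proof. by move=> -> ->. Qed.

Lemma dotp_point x y v : dotp (point x y) v = x * v 0 ord0 + y * v 0 ord_max.
Proof. by rewrite /dotp big_ord2 !mxE. Qed.

Definition mx2 (a b c d : int) : 'M[int]_2 :=
  \matrix_(i, j) if i == 0 :> nat then (if j == 0 :> nat then a else b)
                 else (if j == 0 :> nat then c else d).

(** The primed integers are the entries of the inverse of the matrix of edge directions;
    they compute the coordinates of [v] in the corner. *)
Lemma corner2 (V : seq 'rV[R]_2) x y (a b c d a' b' c' d' : int) :
  [/\ a * a' + b * c' = 1, a * b' + b * d' = 0, c * a' + d * c' = 0 & c * b' + d * d' = 1] ->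
  (forall v, v \in V -> 0 <= (v 0 ord0 - x) * a'%:~R + (v 0 ord_max - y) * c'%:~R /\
                        0 <= (v 0 ord0 - x) * b'%:~R + (v 0 ord_max - y) * d'%:~R) ->
  (exists2 t : R, 0 < t & point (x + t * a%:~R) (y + t * b%:~R) \in V) ->
  (exists2 t : R, 0 < t & point (x + t * c%:~R) (y + t * d%:~R) \in V) ->
  exists B C : 'M[int]_2, [/\ B *m C = 1%:M,
    forall v (i : 'I_2), v \in V -> 0 <= ((v - point x y) *m map_mx intr C) 0 i &
    forall i : 'I_2, exists2 t : R, 0 < t & point x y + t *: row i (map_mx intr B) \in V].
Proof.
move=> [aa ab ca cb] cone ray0 ray1; exists (mx2 a b c d), (mx2 a' b' c' d'); split.
- have sum2 (F : 'I_2 -> int) : \sum_i F i = F ord0 + F ord_max.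
    by rewrite big_ord_recl big_ord1; congr (_ + F _); exact/val_inj.
  by apply/matrixP; apply: ord2P; apply: ord2P; rewrite !mxE sum2 !mxE.
- move=> v i /cone[c0 c1]; move: i.
  by apply: ord2P; rewrite mxE big_ord2 !mxE.
- apply: ord2P.
    have [t t0 tV] := ray0; exists t => //.
    suff -> : point x y + t *: row ord0 (map_mx intr (mx2 a b c d)) =
      point (x + t * a%:~R) (y + t * b%:~R) by [].
    by apply: row2P; rewrite !mxE.
  have [t t0 tV] := ray1; exists t => //.
  suff -> : point x y + t *: row ord_max (map_mx intr (mx2 a b c d)) =
    point (x + t * c%:~R) (y + t * d%:~R) by [].
  by apply: row2P; rewrite !mxE.
Qed.

Definition triangular j : R := j%:R * (j%:R + 1) / 2.

Lemma triangular_ge0 j : 0 <= triangular j.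
Proof. by rewrite /triangular divr_ge0// mulr_ge0. Qed.

Lemma triangularS j : triangular j.+1 = triangular j + j.+1%:R.
Proof. by rewrite /triangular -natr1; field. Qed.

(** The square with vertices (-1, 0), (0, 0), (0, 1), (-1, 1), whose right side is moved
    outwards to make room for a chain of [K] small edges of slopes 1, ..., [K] between
    the bottom side and the right side. *)
Definition polygon_vertices K eps : seq 'rV[R]_2 :=
  [seq point (eps * j%:R) (eps * triangular j) | j <- iota 0 K.+1] ++
  [:: point (eps * K%:R) 1; point (-1) 1; point (-1) 0].

Lemma polygon_chain_mem K eps j : (j <= K)%N ->
  point (eps * j%:R) (eps * triangular j) \in polygon_vertices K eps.
Proof.
move=> jK; rewrite mem_cat; apply/orP; left.
by apply: (map_f (fun j => point (eps * j%:R) (eps * triangular j))); rewrite mem_iota.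
Qed.

Lemma polygon_verticesP K eps v : v \in polygon_vertices K eps ->
  [\/ exists2 j, (j <= K)%N & v = point (eps * j%:R) (eps * triangular j),
      v = point (eps * K%:R) 1, v = point (-1) 1 | v = point (-1) 0].
Proof.
rewrite mem_cat => /orP[/mapP[j]|].
  by rewrite mem_iota ltnS => /= jK ->; constructor 1; exists j.
rewrite !inE => /or3P[] /eqP ->.
- by constructor 2.
- by constructor 3.
- by constructor 4.
Qed.

(** Consecutive integers do not have opposite signs. *)
Lemma consecutive_ge0 i j : 0 <= (i%:R - j%:R) * (i%:R - j%:R + 1) :> R.
Proof.
have [ij|ji] := leqP j i.
  by rewrite -natrB// mulr_ge0// addr_ge0.
have -> : (i%:R - j%:R) * (i%:R - j%:R + 1) = (j%:R - i%:R) * (j%:R - i%:R - 1) :> R.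
  by ring.
have ? : i%:R + 1 <= j%:R :> R by rewrite natr1 ler_nat.
by rewrite mulr_ge0; lra.
Qed.

Section bounds.
Variables (K : nat) (eps : R).
Hypotheses (eps0 : 0 < eps) (epsK : eps * triangular K < 1).

Let chain_le j : (j <= K)%N -> eps * triangular j <= eps * triangular K.
Proof.
move=> jK; rewrite ler_pM2l// /triangular ler_pM2r// ler_pM ?addr_ge0//.
  by rewrite ler_nat.
by rewrite lerD2r ler_nat.
Qed.

(** The bound is the equation of the line that carries the edge of slope [j] of the
    chain. *)
Lemma polygon_slope j v : (j <= K)%N -> v \in polygon_vertices K eps ->
  j%:R * v 0 ord0 - eps * (j%:R * (j%:R - 1) / 2) <= v 0 ord_max.
Proof.
move=> jK.
have chain i : j%:R * (eps * i%:R) - eps * (j%:R * (j%:R - 1) / 2) <=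
    eps * triangular i.
  rewrite -subr_ge0.
  have -> : eps * triangular i - (j%:R * (eps * i%:R) - eps * (j%:R * (j%:R - 1) / 2)) =
     eps * ((i%:R - j%:R) * (i%:R - j%:R + 1) / 2) by rewrite /triangular; field.
  by rewrite mulr_ge0 ?(ltW eps0)// divr_ge0// consecutive_ge0.
have left0 : j%:R * (-1) - eps * (j%:R * (j%:R - 1) / 2) <= 0.
  have := chain 0; rewrite mulr0 mulr0 sub0r /triangular mul0r mul0r mulr0.
  have : 0 <= j%:R :> R by [].
  by lra.
case/polygon_verticesP => [[i iK ->]|->|->|->]; rewrite point_x point_y//.
  by apply: le_trans (chain K) _; exact: ltW.
exact: le_trans left0 _.
Qed.

Lemma polygon_box v : v \in polygon_vertices K eps ->
  [/\ -1 <= v 0 ord0, v 0 ord0 <= eps * K%:R, 0 <= v 0 ord_max & v 0 ord_max <= 1].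
Proof.
have K0 : 0 <= eps * K%:R by rewrite mulr_ge0// ltW.
case/polygon_verticesP => [[i iK ->]|->|->|->]; rewrite point_x point_y; split; try lra.
- by apply: (@le_trans _ _ 0); [rewrite oppr_le0|rewrite mulr_ge0// ltW].
- by rewrite ler_pM2l// ler_nat.
- by rewrite mulr_ge0 ?(ltW eps0)// triangular_ge0.
- by apply: le_trans (chain_le iK) _; exact: ltW.
Qed.

(** Consecutive edges of the chain have directions [(1, j)] and [(1, j + 1)], of
    determinant 1, and its last edge meets a vertical one. *)
Lemma polygon_smooth : smooth_vertices (polygon_vertices K eps).
Proof.
have K0 : 0 <= eps * K%:R by rewrite mulr_ge0// ltW.
have memR : point (eps * K%:R) 1 \in polygon_vertices K eps.
  by rewrite mem_cat !inE eqxx ?orbT.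
have memL1 : point (-1) 1 \in polygon_vertices K eps.
  by rewrite mem_cat !inE eqxx ?orbT.
have memL0 : point (-1) 0 \in polygon_vertices K eps.
  by rewrite mem_cat !inE eqxx ?orbT.
move=> x; case/polygon_verticesP => [[j jK ->]|->|->|->].
- have back : exists2 t : R, 0 < t & point (eps * j%:R + t * (-1)%:~R)
      (eps * triangular j + t * (- j%:Z)%:~R) \in polygon_vertices K eps.
    case: j jK => [|j] jK.
      exists 1 => //; apply: (point_mem _ _ memL0).
        by rewrite rmorphN1; ring.
      by rewrite /triangular rmorphN /=; ring.
    exists eps => //; apply: (point_mem _ _ (polygon_chain_mem eps (ltnW jK))).
      by rewrite -natr1 rmorphN1; ring.
    by rewrite triangularS rmorphN/= -pmulrn; ring.
  have slope_j v : v \in polygon_vertices K eps ->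
      0 <= (v 0 ord0 - eps * j%:R) * (- j%:Z)%:~R + (v 0 ord_max - eps * triangular j) * 1.
    move=> /(polygon_slope jK); rewrite rmorphN/= -pmulrn /triangular => ?; lra.
  move: jK; rewrite leq_eqVlt => /predU1P[jK|jK].
    apply: (@corner2 _ _ _ (-1) (- j%:Z) 0 1 (-1) (- j%:Z) 0 1) => //.
    + by split; ring.
    + move=> v vV; split; last exact: slope_j.
      have [_ + _ _] := polygon_box vV; rewrite jK rmorphN1 mulr0 => ?; lra.
    + exists (1 - eps * triangular K); first by rewrite subr_gt0.
      apply: (point_mem _ _ memR); rewrite jK; first by rewrite mulr0 addr0.
      by rewrite mulr1 addrC subrK.
  apply: (@corner2 _ _ _ (-1) (- j%:Z) 1 (j.+1%:Z) (- j.+1%:Z) (- j%:Z) 1 1) => //.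
  + by split; rewrite ?intS; ring.
  + move=> v vV; split; last exact: slope_j.
    have := polygon_slope jK vV.
    by rewrite rmorphN/= -pmulrn /triangular -natr1 => ?; lra.
  + exists eps => //; apply: (point_mem _ _ (polygon_chain_mem eps jK)).
      by rewrite -natr1; ring.
    by rewrite triangularS -pmulrn; ring.
- apply: (@corner2 _ _ _ 0 (-1) (-1) 0 0 (-1) (-1) 0); first by split.
  + by move=> v /polygon_box[? ? ? ?]; rewrite rmorphN1 mulr0 mulr0; split; lra.
  + exists (1 - eps * triangular K); first by rewrite subr_gt0.
    apply: (point_mem _ _ (polygon_chain_mem eps (leqnn K))).
      by rewrite mulr0 addr0.
    by rewrite rmorphN1; ring.
  + exists (1 + eps * K%:R); first lra.
    by apply: (point_mem _ _ memL1); rewrite ?rmorphN1; ring.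
- apply: (@corner2 _ _ _ 1 0 0 (-1) 1 0 0 (-1)); first by split.
  + by move=> v /polygon_box[? ? ? ?]; rewrite rmorphN1 mulr0 mulr0; split; lra.
  + exists (1 + eps * K%:R); first lra.
    by apply: (point_mem _ _ memR); ring.
  + exists 1 => //.
    by apply: (point_mem _ _ memL0); rewrite ?rmorphN1; ring.
- apply: (@corner2 _ _ _ 1 0 0 1 1 0 0 1); first by split.
  + by move=> v /polygon_box[? ? ? ?]; rewrite mulr0 mulr0; split; lra.
  + exists 1 => //; apply: (point_mem _ _ (polygon_chain_mem eps (leq0n K))).
      by ring.
    by rewrite /triangular; ring.
  + by exists 1 => //; apply: (point_mem _ _ memL1); ring.
Qed.

End bounds.

Lemma polygon_near K eps : 0 < eps -> eps * triangular K < 1 ->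
  forall (d : R), eps * K%:R <= d -> eps * triangular K <= d ->
  (forall v, v \in polygon_vertices K eps ->
     exists2 w, w \in polygon_vertices 0 1 & l2norm (v - w) <= 2%:R * d) /\
  (forall w, w \in polygon_vertices 0 1 ->
     exists2 v, v \in polygon_vertices K eps & l2norm (v - w) <= 2%:R * d).
Proof.
move=> eps0 epsK d Kd Td.
have d0 : 0 <= d by apply: le_trans Kd; rewrite mulr_ge0// ltW.
have close v w : `|v 0 ord0 - w 0 ord0| <= d -> `|v 0 ord_max - w 0 ord_max| <= d ->
    l2norm (v - w : 'rV[R]_2) <= 2%:R * d.
  by move=> h0 h1; apply: l2norm_le_coord; apply: ord2P; rewrite !mxE.
have close0 v : l2norm (v - v : 'rV[R]_2) <= 2%:R * d.
  by rewrite subrr l2norm0 mulr_ge0.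
have mem0 : point 0 0 \in polygon_vertices 0 1.
  apply: (point_mem _ _ (polygon_chain_mem 1 (leqnn 0))); first by rewrite mulr0.
  by rewrite /triangular; ring.
have mem1 : point 0 1 \in polygon_vertices 0 1.
  by rewrite mem_cat !inE mulr0 eqxx ?orbT.
have memL y K' eps' : y \in [:: 1; 0 : R] -> point (-1) y \in polygon_vertices K' eps'.
  by rewrite mem_cat !inE => /orP[] /eqP ->; rewrite eqxx ?orbT.
have memR : point (eps * K%:R) 1 \in polygon_vertices K eps.
  by rewrite mem_cat !inE eqxx ?orbT.
split=> v; case/polygon_verticesP => [[j jK ->]|->|->|->].
- exists (point 0 0) => //; apply: close; rewrite !mxE/= subr0 ger0_norm.
  + by apply: le_trans Kd; rewrite ler_pM2l// ler_nat.
  + by rewrite mulr_ge0// ltW.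
  + apply: le_trans Td; rewrite ler_pM2l// /triangular ler_pM2r// ler_pM ?addr_ge0//.
      by rewrite ler_nat.
    by rewrite lerD2r ler_nat.
  + by rewrite mulr_ge0 ?(ltW eps0)// triangular_ge0.
- exists (point 0 1) => //; apply: close; rewrite !mxE/= ?subrr ?normr0// subr0.
  by rewrite ger0_norm// mulr_ge0// ltW.
- by exists (point (-1) 1); rewrite ?memL ?mem_head.
- by exists (point (-1) 0); rewrite ?memL ?inE ?eqxx ?orbT.
- move: jK; rewrite leqn0 => /eqP ->.
  exists (point (eps * 0%:R) (eps * triangular 0)); first exact: polygon_chain_mem.
  by apply: close; rewrite !mxE/= /triangular ?mulr0n ?mul0r ?mul0r ?mulr0 subrr normr0.
- exists (point (eps * K%:R) 1) => //; apply: close; rewrite !mxE/= ?subrr ?normr0//.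
  by rewrite mulr0 subr0 ger0_norm// mulr_ge0// ltW.
- by exists (point (-1) 1); rewrite ?memL ?mem_head.
- by exists (point (-1) 0); rewrite ?memL ?inE ?eqxx ?orbT.
Qed.

End polygon.

(** * Kinks of support functions *)

Section kinks.
Context {R : realType} {n : nat}.
Implicit Types (a u v x y : 'rV[R]_n) (P Q : polytope R n) (N : set (set 'rV[R]_n)).

(** For large [t] the values at two points compare like those of [v], or like those of
    [u] if the former agree. *)
Lemma eventual_max (s : seq 'rV[R]_n) v u : s != [::] ->
  exists2 x, x \in s & exists k : nat, forall (t : R) y, k%:R <= t -> y \in s ->
    dotp (t *: v + u) y <= dotp (t *: v + u) x.
Proof.
elim: s => [//|z s IH] _; have [->|s0] := eqVneq s [::].
  by exists z; rewrite ?mem_head//; exists 0 => t y _; rewrite inE => /eqP ->.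
have [x xs [k xmax]] := IH s0.
have compare a b : exists m : nat, (forall t : R, m%:R <= t ->
      dotp (t *: v + u) a <= dotp (t *: v + u) b) \/
    (forall t : R, m%:R <= t -> dotp (t *: v + u) b <= dotp (t *: v + u) a).
  wlog ab : a b / dotp v a <= dotp v b => [wl|].
    have [ab|/ltW ba] := leP (dotp v a) (dotp v b); first exact: wl.
    by have [m [|]] := wl _ _ ba; exists m; [right|left].
  have dotpE' c t : dotp (t *: v + u) c = t * dotp v c + dotp u c.
    by rewrite dotpDl dotpZl.
  move: ab; rewrite le_eqVlt => /predU1P[ab|ab].
    have [uab|/ltW uba] := leP (dotp u a) (dotp u b).
      by exists 0; left => t _; rewrite !dotpE' ab lerD2l.
    by exists 0; right => t _; rewrite !dotpE' ab lerD2l.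
  exists (Num.truncn ((dotp u a - dotp u b) / (dotp v b - dotp v a))).+1; left => t mt.
  have : (dotp u a - dotp u b) / (dotp v b - dotp v a) <= t.
    by apply: le_trans mt; exact: ltW (truncnS_gt _).
  rewrite ler_pdivrMr ?subr_gt0// !dotpE'; lra.
have [m [zx|xz]] := compare z x.
- exists x; first by rewrite inE xs orbT.
  exists (maxn k m) => t y; rewrite natr_max ge_max => /andP[kt mt].
  by rewrite inE => /predU1P[->|ys]; [exact: zx|exact: xmax].
- exists z; first by rewrite mem_head.
  exists (maxn k m) => t y; rewrite natr_max ge_max => /andP[kt mt].
  rewrite inE => /predU1P[->//|ys]; apply: le_trans (xmax _ _ kt ys) _; exact: xz.
Qed.

(** Far away, a line stays in one cone of a normal fan: the point at which the functional
    attains its maximum is eventually fixed, and an affine function of one variable that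
    is nonnegative and vanishes at an interior point is zero. *)
Lemma fan_eventual_cone N v u : polytopal_fan N ->
  exists (k : nat) C, N C /\ forall t : R, k%:R <= t -> C (t *: v + u).
Proof.
move=> [P pP ->]; have [s [s0 PE]] := pP.
have [x xs [k xmax0]] := eventual_max v u s0.
have Px : P x by rewrite PE; exact: mem_conv.
have xmax (t : R) y : k%:R <= t -> P y -> dotp (t *: v + u) y <= dotp (t *: v + u) x.
  by move=> kt; rewrite PE; apply: conv_dotp_le => z zs; exact: xmax0.
pose F := face P ((k%:R + 1) *: v + u).
exists k, (normal_cone P F); split.
  exists F => //; split; last by exists ((k%:R + 1) *: v + u).
  by exists x; split => // y Py; apply: xmax => //; rewrite lerDl.
move=> t kt p q [Pp pmax] Pq; rewrite dotpDr dotpNr subr_ge0.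
apply: le_trans (xmax _ _ kt Pq) _.
have h0 := xmax k%:R p (lexx _) Pp.
have h1 : dotp ((k%:R + 2) *: v + u) p <= dotp ((k%:R + 2) *: v + u) x.
  by apply: xmax => //; rewrite lerDl.
have := pmax _ Px; move: h0 h1; rewrite !dotpDl !dotpZl => h0 h1 h2.
have vpx : dotp v p = dotp v x by lra.
by rewrite vpx in h0 h1 h2 *; lra.
Qed.

(** The second difference of the normalized support function on an arithmetic
    progression of directions; it detects walls of the normal fan. *)
Definition kink v u k P : R :=
  shape_support P (k.+2%:R *: v + u) + shape_support P (k%:R *: v + u)
  - 2 * shape_support P (k.+1%:R *: v + u).

Lemma kinkE v u k P : kink v u k P * radius P =
  support_function P (k.+2%:R *: v + u) + support_function P (k%:R *: v + u)
  - 2 * support_function P (k.+1%:R *: v + u).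
Proof.
rewrite /kink !shape_supportE !dotpDl !dotpZl -!natr1; ring.
Qed.

Lemma kink_fan_eq0 N v u : polytopal_fan N -> exists k0 : nat,
  forall k P, (k0 <= k)%N -> refines N (normal_fan P) -> kink v u k P = 0.
Proof.
move=> pN; have [k0 [C [NC Ct]]] := fan_eventual_cone v u pN.
exists k0 => k P k0k /(_ _ NC)[_ [F [[x Fx] [a FE]] ->] CF].
have Px : (P : set _) x by move: Fx; rewrite FE => -[].
have h j : (k <= j)%N -> support_function P (j%:R *: v + u) = dotp (j%:R *: v + u) x.
  move=> kj; apply: support_eq => // y Py; rewrite -subr_ge0 -dotpNr -dotpDr.
  by apply: CF Fx Py; apply: Ct; rewrite ler_nat (leq_trans k0k).
have k2 : (k <= k.+2)%N := leqW (leqnSn k).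
have := kinkE v u k P; rewrite (h _ (leqnn k)) (h _ (leqnSn k)) (h _ k2) !dotpDl !dotpZl.
have -> : k.+2%:R * dotp v x + dotp u x + (k%:R * dotp v x + dotp u x) -
    2 * (k.+1%:R * dotp v x + dotp u x) = 0 by rewrite -!natr1; ring.
by move=> /eqP; rewrite mulf_eq0 (gt_eqF (polytope_radius_gt0 P)) orbF => /eqP.
Qed.

Lemma kink_close v u k P Q d : shape_close d P Q ->
  kink v u k Q <= kink v u k P + d * (l2norm (k.+2%:R *: v + u) +
    l2norm (k%:R *: v + u) + 2 * l2norm (k.+1%:R *: v + u)).
Proof.
move=> PQ; rewrite /kink.
have := PQ (k.+2%:R *: v + u); have := PQ (k.+1%:R *: v + u); have := PQ (k%:R *: v + u).
rewrite !ler_norml => /andP[? ?] /andP[? ?] /andP[? ?]; lra.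
Qed.

Definition small_kinks v u (c : nat -> R) : set (polytope_shape R n) :=
  [set s | exists P, shape_class P = s /\ forall k, kink v u k P < c k].

(** On a cell only finitely many kinks are not zero, so the conditions that define this
    set reduce to finitely many open ones. *)
Lemma small_kinks_open v u c : (forall k, 0 < c k) -> open (small_kinks v u c).
Proof.
move=> c0; suff : CW_open (small_kinks v u c) by [].
rewrite CW_openE => N pN _; rewrite openE => P [P' [P'P P'c]].
have Pc k : kink v u k (fan_polytope P) < c k.
  by rewrite /kink -(same_shape_support (shape_class_eq P'P)); exact: P'c.
have FP := nbhs_filter P.
have [k0 kink0] := kink_fan_eq0 v u pN.
have near_k k : \forall Q \near P, kink v u k (fan_polytope Q) < c k.
  pose L := l2norm (k.+2%:R *: v + u) + l2norm (k%:R *: v + u)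
    + 2 * l2norm (k.+1%:R *: v + u).
  have L0 : 0 < L + 1 by rewrite /L ltr_wpDl// !addr_ge0 ?mulr_ge0 ?l2norm_ge0.
  pose e := (c k - kink v u k (fan_polytope P)) / (L + 1).
  have e0 : 0 < e by rewrite divr_gt0// subr_gt0.
  have [d d0 close] := shape_close_support_close (fan_polytope P) e0.
  apply: (@filterS _ _ FP _ _ _ (near_support_close P d0)) => Q /close/kink_close.
  move=> /(_ v u k)/le_lt_trans; apply; rewrite -/L -ltrBrDl.
  have -> : c k - kink v u k (fan_polytope P) = e * (L + 1) by rewrite divfK// gt_eqF.
  by rewrite ltr_pM2l// ltrDl.
have near_all m : \forall Q \near P, forall k, (k < m)%N -> kink v u k (fan_polytope Q) < c k.
  elim: m => [|m IH]; first by apply: (filterE FP).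
  apply: (filterS2 FP _ (near_k m) IH) => Q Qm QIH k.
  by rewrite ltnS leq_eqVlt => /predU1P[->//|]; exact: QIH.
apply: (@filterS _ _ FP _ _ _ (near_all k0)) => Q Qc; exists (fan_polytope Q); split => // k.
have [/Qc//|k0k] := ltnP k k0.
by rewrite kink0//; exact: set_mem (valP (Q : fan_polytopes N)).
Qed.

Lemma CW_topology_shape (V : set (polytope_shape R n)) S : open V ->
  CW_topology S ([set P | V (shape_class P)] `&` S).
Proof.
move=> oV; exists (@CW_coordinates R n @^-1` ((fst \o fst) @^-1` V)) => //.
exists ((fst \o fst) @^-1` V) => //; apply: open_comp => //.
by move=> z _; apply: continuous_comp; exact: cvg_fst.
Qed.

(** A sequence of polytopes whose kinks occur at ever farther directions and that
    converges to a polytope without kinks is avoided by a CW neighbourhood of its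
    limit. *)
Lemma CW_topology_not_sub dist S v u P (Q : nat -> polytope R n) :
  support_controlled dist ->
  S P -> (forall k, S (Q k)) ->
  (forall e, 0 < e -> exists k, support_close e P (Q k)) ->
  (forall k, kink v u k P = 0) -> (forall k, 0 < kink v u k (Q k)) ->
  ~ (CW_topology S `<=` metric_topology dist S).
Proof.
move=> small SP SQ QP P0 Qpos CWsub.
pose c k := kink v u k (Q k).
have /CWsub[_] := CW_topology_shape S (@small_kinks_open v u c Qpos).
move=> /(_ P) []; first by split => //; exists P; split => // k; rewrite P0; exact: Qpos.
move=> e e0 ball_e; have [d d0 de] := small P e e0.
have [k Qk] := QP d d0.
have [[Q' [Q'Q Q'c]] _] := ball_e _ (SQ k) (de _ Qk).
by have := Q'c k; rewrite /kink (same_shape_support (shape_class_eq Q'Q)) ltxx.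
Qed.

End kinks.

(** * Prisms over the polygons converge *)

Section approximation.
Context {R : realType}.

Lemma support_close_vertices n (s s' : seq 'rV[R]_n) (e : R) : s != [::] -> s' != [::] ->
  (forall x, x \in s -> exists2 y, y \in s' & l2norm (x - y) <= e) ->
  (forall y, y \in s' -> exists2 x, x \in s & l2norm (x - y) <= e) ->
  support_close e (conv s) (conv s').
Proof.
have half (r r' : seq 'rV[R]_n) a : r != [::] -> r' != [::] ->
    (forall x, x \in r -> exists2 y, y \in r' & l2norm (x - y) <= e) ->
    support_function (conv r) a - support_function (conv r') a <= e * l2norm a.
  move=> r0 r'0 near; rewrite lerBlDl; apply: support_le; first by exists r.
  apply: conv_dotp_le => x /near[y yr' xy].
  have -> : dotp a x = dotp a y + dotp a (x - y) by rewrite dotpDr dotpNr addrC subrK.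
  rewrite lerD//; first by apply: dotp_le_support (mem_conv yr'); exists r'.
  by apply: le_trans (cauchy_schwarz _ _) _; rewrite mulrC ler_wpM2r// l2norm_ge0.
move=> s0 s'0 ss' s's a; rewrite ler_norml lerNl opprB !half// => y /s's[x xs xy].
by exists x => //; rewrite l2norm_distC.
Qed.

Variable m : nat.

Definition prism_vertices K (eps : R) : seq 'rV[R]_(2 + m) :=
  vertex_product (polygon_vertices K eps) (cube_vertices m).

Lemma prism_vertices_neq0 K eps : prism_vertices K eps != [::].
Proof. exact: vertex_product_neq0 (cube_vertices_neq0 m). Qed.

Lemma dotp_row_mx (a x : 'rV[R]_2) (y : 'rV[R]_m) : dotp (row_mx a 0) (row_mx x y) = dotp a x.
Proof. by rewrite !dotpE tr_row_mx mul_row_col mul0mx addr0. Qed.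

Lemma prism_delzant K eps : 0 < eps -> eps * triangular K < 1 ->
  is_delzant (conv (prism_vertices K eps)).
Proof.
move=> eps0 epsK; apply: smooth_conv_delzant; first exact: prism_vertices_neq0.
by apply: smooth_vertex_product; [exact: polygon_smooth|exact: cube_smooth].
Qed.

Lemma cube_vertex : exists c, c \in @cube_vertices R m.
Proof.
by case: cube_vertices (@cube_vertices_neq0 R m) => // c s _; exists c; rewrite mem_head.
Qed.

Lemma prism_mem K eps x c : x \in polygon_vertices K eps -> c \in @cube_vertices R m ->
  row_mx x c \in prism_vertices K eps.
Proof. by move=> xV cV; apply/allpairsP; exists (x, c). Qed.

Lemma prism_not_point K eps : ~ is_point (conv (prism_vertices K eps)).
Proof.
have [c cV] := cube_vertex; case=> x xE.
have eq_x y : y \in polygon_vertices K eps -> row_mx y c = x.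
  by move=> yV; have := mem_conv (prism_mem yV cV); rewrite xE.
have : row_mx (point (-1) 1) c = row_mx (point (-1) 0) c :> 'rV[R]_(2 + m).
  by rewrite !eq_x// mem_cat !inE eqxx ?orbT.
move=> /eq_row_mx[/(congr1 (fun z : 'rV[R]_2 => z 0 ord_max))].
by rewrite !point_y => /eqP; rewrite oner_eq0.
Qed.

Definition prism K eps : polytope R (2 + m) :=
  Polytope (ex_intro _ _ (conj (prism_vertices_neq0 K eps) erefl)) (@prism_not_point K eps).

Let v : 'rV[R]_(2 + m) := row_mx (point 1 0) 0.
Let u : 'rV[R]_(2 + m) := row_mx (point 0 (-1)) 0.

Let dotp_vu (t : R) x c : dotp (t *: v + u) (row_mx x c) = t * x 0 ord0 - x 0 ord_max.
Proof. by rewrite dotpDl dotpZl !dotp_row_mx !dotp_point; ring. Qed.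

Lemma square_kink k : kink v u k (prism 0 1) = 0.
Proof.
have h j : support_function (prism 0 1) (j%:R *: v + u) = 0.
  have [c cV] := cube_vertex.
  have V0 := @polygon_chain_mem R 0 1 0 (leqnn 0).
  have e0 : 1 * triangular 0 = 0 :> R by rewrite /triangular; ring.
  have := prism_mem V0 cV => /mem_conv Pc.
  have Pc0 : dotp (j%:R *: v + u) (row_mx (point (1 * 0%:R) (1 * triangular 0)) c) = 0.
    by rewrite dotp_vu point_x point_y e0 !mulr0 subr0.
  rewrite -Pc0; apply: support_eq => //.
  apply: conv_dotp_le => _ /allpairsP[[x d] [/= xV _ ->]].
  rewrite Pc0 dotp_vu subr_le0.
  have [] := @polygon_box R 0 1 ltr01 _ x xV; first by rewrite e0.
  rewrite mulr0 => _ x0 y0 _; apply: le_trans y0.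
  by rewrite mulr_ge0_le0.
have := kinkE v u k (prism 0 1); rewrite !h mulr0 subr0 addr0 => /eqP.
by rewrite mulf_eq0 (gt_eqF (polytope_radius_gt0 _)) orbF => /eqP.
Qed.

(** The direction [k.+1%:R *: v + u] is normal to the last edge of the chain, and the
    next and previous directions of the progression are evaluated at different ends of
    this edge. *)
Lemma chain_kink k eps : 0 < eps -> eps * triangular k.+1 < 1 ->
  0 < kink v u k (prism k.+1 eps).
Proof.
move=> eps0 epsK; have [c cV] := cube_vertex.
rewrite -(pmulr_lgt0 _ (polytope_radius_gt0 (prism k.+1 eps))) kinkE.
have pP := psetP (prism k.+1 eps).
have ge_at (t : R) j : (j <= k.+1)%N -> t * (eps * j%:R) - eps * triangular j <=
    support_function (prism k.+1 eps) (t *: v + u).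
  move=> jk; have := mem_conv (prism_mem (polygon_chain_mem eps jk) cV).
  by move=> /(dotp_le_support (t *: v + u) pP); rewrite dotp_vu point_x point_y.
have le_mid : support_function (prism k.+1 eps) (k.+1%:R *: v + u) <=
    eps * (k.+1%:R * (k.+1%:R - 1) / 2).
  apply: support_le => //; apply: conv_dotp_le => _ /allpairsP[[x d] [/= xV _ ->]].
  rewrite dotp_vu; have := polygon_slope eps0 epsK (leqnn _) xV; lra.
have := ge_at k.+2%:R k.+1 (leqnn _); have := ge_at k%:R k (leqnSn _).
have k1 : k.+1%:R = k%:R + 1 :> R by rewrite natr1.
have k2 : k.+2%:R = k%:R + 1 + 1 :> R by rewrite !natr1.
move: le_mid; rewrite /triangular k2 k1 => h1 h2 h3.
by have := eps0; lra.
Qed.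

(** The chain of [k + 1] edges has a height quadratic in [k] before scaling, so a cubic
    factor makes it shrink to a point. *)
Definition chain_scale k : R := k.+2%:R ^- 3.

Lemma chain_scale_gt0 k : 0 < chain_scale k.
Proof. by rewrite invr_gt0 exprn_gt0. Qed.

Lemma chain_scale_bounds k :
  chain_scale k * k.+1%:R <= k.+2%:R^-1 /\ chain_scale k * triangular k.+1 <= k.+2%:R^-1.
Proof.
rewrite /chain_scale /triangular -exprVn; set N : R := k.+2%:R.
have -> : k.+1%:R = N - 1 :> R by rewrite /N -[k.+2%:R]natr1 addrK.
have zN : N^-1 * N = 1 by rewrite mulVf// pnatr_eq0.
have z0 : 0 < N^-1 by rewrite invr_gt0.
have z1 : N^-1 <= 1 by rewrite invf_le1// ler1n.
move: zN z0 z1; move: (N^-1) => z zN z0 z1.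
have -> : z ^+ 3 * (N - 1) = z * z * (z * N) - z * z * z by ring.
have -> : z ^+ 3 * ((N - 1) * (N - 1 + 1) / 2) = (z * (z * N) - z * z) * (z * N) / 2.
  by ring.
rewrite zN !mulr1.
have zz0 : 0 <= z * z by rewrite mulr_ge0 ?(ltW z0).
have zz1 : z * z <= z by rewrite ger_pMr.
have zzz0 : 0 <= z * z * z by rewrite mulr_ge0 ?(ltW z0).
by split; lra.
Qed.

Lemma chain_scale_small k : chain_scale k * triangular k.+1 < 1.
Proof.
apply: le_lt_trans (chain_scale_bounds k).2 _.
by rewrite invf_lt1// ltr1n.
Qed.

Lemma prism_cvg (e : R) : 0 < e ->
  exists k, support_close e (prism 0 1) (prism k.+1 (chain_scale k)).
Proof.
move=> e0; pose k := Num.truncn (2 / e); exists k.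
have [K_le T_le] := chain_scale_bounds k.
have [near1 near2] := polygon_near (chain_scale_gt0 k) (chain_scale_small k) K_le T_le.
have ke : 2%:R * k.+2%:R^-1 <= e.
  rewrite ler_pdivrMr// -ler_pdivrMl// mulrC; apply/ltW.
  by apply: lt_trans (truncnS_gt _) _; rewrite ltr_nat.
have norm_row_mx (x y : 'rV[R]_2) (c : 'rV[R]_m) :
    l2norm (row_mx x c - row_mx y c) = l2norm (x - y).
  by rewrite opp_row_mx add_row_mx subrr /l2norm dotp_row_mx.
apply/support_closeC/support_close_vertices; try exact: prism_vertices_neq0.
- move=> _ /allpairsP[[x c] [/= /near1[y yV xy] cV ->]].
  by exists (row_mx y c); rewrite ?prism_mem// norm_row_mx (le_trans xy).
- move=> _ /allpairsP[[y c] [/= /near2[x xV xy] cV ->]].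
  by exists (row_mx x c); rewrite ?prism_mem// norm_row_mx (le_trans xy).
Qed.

Lemma prism_CW_not_metric (dist : polytope R (2 + m) -> polytope R (2 + m) -> \bar R) S :
  support_controlled dist ->
  delzant_polytopes `<=` S -> ~ (CW_topology S `<=` metric_topology dist S).
Proof.
move=> small dS.
apply: (@CW_topology_not_sub _ _ _ _ v u (prism 0 1)
  (fun k => prism k.+1 (chain_scale k)) small).
- by apply: dS; apply: prism_delzant => //; rewrite /triangular; lra.
- by move=> k; apply: dS; apply: prism_delzant (chain_scale_gt0 k) (chain_scale_small k).
- exact: prism_cvg.
- exact: square_kink.
- by move=> k; exact: chain_kink (chain_scale_gt0 k) (chain_scale_small k).
Qed.

End approximation.

(** * Comparison of the topologies *)

Section comparison.
Context {R : realType} {n : nat}.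
Implicit Types (P Q : polytope R n).

Lemma hausdorff_support_controlled :
  support_controlled (fun P Q => (hausdorff_dist P Q)%:E).
Proof.
move=> P e e0; exists (e / 2) => [|Q PQ]; first by rewrite divr_gt0.
rewrite lte_fin; apply: (@le_lt_trans _ _ (e / 2)); last lra.
by apply: hausdorff_dist_le PQ; rewrite ?divr_ge0 ?(ltW e0)//; exact: psetP.
Qed.

Lemma volume_support_controlled : (0 < n)%N ->
  support_controlled (fun P Q => volume_dist P Q).
Proof.
move=> n0 P e e0; have [d d0 dP] := volume_dist_small n0 (psetP P) e0.
by exists d => // Q; exact: dP (psetP Q).
Qed.

End comparison.

Theorem proposition3p49 (R : realType) (n : nat) (n_gt0 : (0 < n)%N)
    (S : set (polytope R n))
    (metric : set (polytope R n) -> set_system (polytope R n))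
    (HS : [\/ S = all_polytopes, S = rational_polytopes
            | S = delzant_polytopes])
    (Hmetric : metric = volume_topology \/ metric = hausdorff_topology) :
  metric S `<=` CW_topology S /\
  ((1 < n)%N -> metric S `<` CW_topology S).
Proof.
have [dist small ->] : exists2 dist : polytope R n -> polytope R n -> \bar R,
    support_controlled dist & metric = metric_topology dist.
  case: Hmetric => ->.
  - by exists (fun P Q => volume_dist P Q) => //; exact: volume_support_controlled.
  - by exists (fun P Q => (hausdorff_dist P Q)%:E) => //; exact: hausdorff_support_controlled.
have sub := @metric_topology_sub R n dist S small.
split=> // n_gt1; split=> //.
have dS : delzant_polytopes `<=` S by case: HS => -> // P [].
case: n n_gt1 S dist small dS {HS sub Hmetric n_gt0 metric} => [//|[//|m]] _ S dist.
exact: prism_CW_not_metric.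
Qed.
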